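(* Consider the status updating system described in the context, operating under the randomized highest $k$ selective encoding scheme with parameter $\alpha\in[0,1]$, arrival rate $\lambda>0$, and codeword lengths $\ell(x_1),\dots,\ell(x_n)$. Then the long term average age at the receiver node is $$\Delta_\alpha=\frac{\mathbb{E}[L^2]+\frac{2}{q_{k,\alpha}\lambda}\mathbb{E}[L]+\frac{2}{(q_{k,\alpha}\lambda)^2}}{2\left(\mathbb{E}[L]+\frac{1}{q_{k,\alpha}\lambda}\right)}+\mathbb{E}[L],$$ where $q_{k,\alpha}=\sum_{\ell=1}^kP_X(x_\ell)+\alpha\sum_{\ell=k+1}^nP_X(x_\ell)$, $\mathbb{E}[L]=\sum_{i=1}^nP_{X_\alpha}(x_i)\ell(x_i)$ and $\mathbb{E}[L^2]=\sum_{i=1}^nP_{X_\alpha}(x_i)\ell(x_i)^2$.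
   Context: An information source generates status update packets whose arrival times at a transmitter node form a Poisson process of rate $\lambda>0$. Each packet carries an independent realization of a random variable $X$ taking values in $\{x_1,\dots,x_n\}$ with known pmf $P_X$, where $P_X(x_m)\ge P_X(x_j)$ for all $m\le j$; realizations are independent of the arrival process. Every realization $x_i$ is assigned a binary codeword of length $\ell(x_i)$. Randomized highest $k$ selective encoding with parameter $\alpha\in[0,1]$: when a packet arrives at an idle transmitter, if its realization is $x_i$ with $i\le k$ it is encoded and sent; if $i>k$ it is encoded and sent with probability $\alpha$ and discarded with probability $1-\alpha$ (independently of everything else), in which case the transmitter keeps waiting for the next arrival. Packets arriving while the transmitter is busy are discarded (blocking). Transmission is over an error-free channel at one bit per unit time, so sending $x_i$ takes $\ell(x_i)$ time units, after which the receiver obtains the update and the transmitter becomes idle. Define $q_{k,\alpha}=\sum_{\ell=1}^kP_X(x_\ell)+\alpha\sum_{\ell=k+1}^nP_X(x_\ell)$ and $P_{X_\alpha}(x_i)=P_X(x_i)/q_{k,\alpha}$ for $i\le k$, $P_{X_\alpha}(x_i)=\alpha P_X(x_i)/q_{k,\alpha}$ for $i>k$. The instantaneous age at the receiver is $\Delta(t)=t-u(t)$, where $u(t)$ is the generation (arrival) time of the most recently received update, and the long term average age is $\lim_{T\to\infty}\frac1T\int_0^T\Delta(t)\,dt$. *)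

(* Defs.v *)
From HB Require Import structures.
From mathcomp Require Import all_boot all_order all_algebra.
From mathcomp Require Import all_classical all_reals all_analysis.
Set Implicit Arguments. Unset Strict Implicit. Unset Printing Implicit Defensive.
Import Order.TTheory GRing.Theory Num.Theory.
Import numFieldNormedType.Exports.
Local Open Scope classical_set_scope.
Local Open Scope ring_scope.

Section System.
Variables (R : realType) (n k : nat) (len : 'I_n -> nat).
(* A j = (j+1)-th interarrival time; X j = realization carried by packet j
   (index i : 'I_n stands for x_{i+1}); C j = independent coin used when
   X j is not among the k most likely realizations. *)
Variables (A : nat -> R) (X : nat -> 'I_n) (C : nat -> bool).

Definition arrival (j : nat) : R := \sum_(m < j.+1) A m.

Definition selected (j : nat) : bool := ((X j < k)%N || C j).

(* time at which the transmitter becomes idle, as seen by packet j *)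
Fixpoint free_at (j : nat) : R :=
  match j with
  | 0 => 0
  | j'.+1 => if (free_at j' <= arrival j') && selected j'
             then arrival j' + (len (X j'))%:R else free_at j'
  end.

Definition sent (j : nat) : bool := (free_at j <= arrival j) && selected j.

(* generation time of the most recently received update at time t
   (0 before the first reception, i.e. initial age t) *)
Definition last_gen (t : R) : R :=
  sup [set s | s = 0 \/ exists j, [/\ sent j, arrival j + (len (X j))%:R <= t
                                      & s = arrival j]].

Definition age (t : R) : R := t - last_gen t.

Definition avg_age (T : R) : \bar R :=
  ((T^-1)%:E * \int[lebesgue_measure]_(t in `[0%R, T]%classic) (age t)%:E)%E.
End System.

Definition mutually_independent {d} {T : measurableType d} {R : realType}
  (P : probability T R) (n : nat)
  (A : nat -> T -> R) (X : nat -> T -> 'I_n) (C : nat -> T -> bool) : Prop :=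
  forall (JA JX JC : seq nat) (B : nat -> set R) (S : nat -> set 'I_n)
         (D : nat -> set bool),
  uniq JA -> uniq JX -> uniq JC -> (forall j, measurable (B j)) ->
  P (\big[setI/setT]_(j <- JA) (A j @^-1` B j)
     `&` \big[setI/setT]_(j <- JX) (X j @^-1` S j)
     `&` \big[setI/setT]_(j <- JC) (C j @^-1` D j))
  = (\prod_(j <- JA) P (A j @^-1` B j) *
     \prod_(j <- JX) P (X j @^-1` S j) *
     \prod_(j <- JC) P (C j @^-1` D j))%E.

Section Formula.
Variables (R : realType) (n k : nat) (p : 'I_n -> R) (alpha lambda : R)
  (len : 'I_n -> nat).
Definition q_ka : R :=
  \sum_(i < n | (i < k)%N) p i + alpha * \sum_(i < n | (k <= i)%N) p i.
Definition p_alpha (i : 'I_n) : R :=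
  if (i < k)%N then p i / q_ka else alpha * p i / q_ka.
Definition EL : R := \sum_(i < n) p_alpha i * (len i)%:R.
Definition EL2 : R := \sum_(i < n) p_alpha i * ((len i)%:R ^+ 2).
Definition Delta_alpha : R :=
  (EL2 + 2 / (q_ka * lambda) * EL + 2 / (q_ka * lambda) ^+ 2)
  / (2 * (EL + 1 / (q_ka * lambda))) + EL.
End Formula.

(* Main.v *)
Require Import Defs.
From HB Require Import structures.
From mathcomp Require Import all_boot all_order all_algebra.
From mathcomp Require Import all_classical all_reals all_analysis.
From mathcomp Require Import measurable_realfun.
From mathcomp Require Import ring lra zify.
Set Implicit Arguments. Unset Strict Implicit. Unset Printing Implicit Defensive.
Import Order.TTheory GRing.Theory Num.Theory.
Import numFieldNormedType.Exports.
Local Open Scope classical_set_scope.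
Local Open Scope ring_scope.

(* The system is embedded at the arrival epochs.  With [lag] the signed offset of
   the previous arrival from the end of the last transmission, the pair
   ([lag], [last_len]) is a Markov chain driven by the independent innovations
   (interarrival time, realization, coin), and the area below the age curve up to
   the end of a transmission is a sum of quadratic polynomials in that chain.
   Memorylessness of the exponential law makes the conditional means of the
   moments of the idle time explicit, so the area is, up to telescoping terms, a
   combination of sums of orthogonal random variables with bounded second
   moments.  These obey the strong law of large numbers, and the constant that
   remains is the renewal-reward ratio E[L] + E[Y^2] / (2 E[Y]) with Y = W + L and
   W exponential of rate q lambda. *)

(** The stationary law of the chain is never computed. Given the past, a packet finds the
    transmitter idle with a probability [idle_prob] whose long-run average is left undetermined; it
    cancels once every sum is compared with the number of transmissions. What results is that area
    minus the claimed constant times elapsed time is o(N) after N arrivals. To divide by the elapsed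
    time only a linear lower bound on it is needed, and bounded codeword lengths provide one.
    Indexing by arrivals rather than by transmissions keeps the filtration deterministic: no
    stopping times, no random number of summands. The price is that an idle period spans a geometric
    number of arrivals; its unfinished part is carried along in [lag] and telescopes. Idle times are
    unbounded, so the uniform second moments rest on an exponential moment of the carried idle time.
    It stays bounded because each idle arrival is selected with probability q > 0. This holds even
    for alpha = 0, since the most likely realization is always sent. *)

(** * Independence of generated sigma-algebras *)

Section IndependentSigmaAlgebras.
Context {d : measure_display} {T : measurableType d} {R : realType}.
Variable P : probability T R.
Local Open Scope ereal_scope.

Definition independent_systems (G H : set (set T)) :=
  forall A B, G A -> H B -> P (A `&` B) = P A * P B.

Lemma independent_systemsC G H :
  independent_systems G H -> independent_systems H G.
Proof. by move=> GH A B HA GB; rewrite setIC GH// muleC. Qed.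

(** For fixed B in H, the finite measures A |-> P (A [&] B) and A |-> P B * P A agree on the
    pi-system G, hence on the sigma-algebra it generates. *)
Lemma independent_gen_sigma_l G H : G `<=` measurable -> H `<=` measurable ->
  setI_closed G -> G setT ->
  independent_systems G H -> independent_systems <<s G >> H.
Proof.
move=> Gm Hm GI GT GH A B sGA HB.
have mB := Hm _ HB.
have PB0 : (0 <= fine (P B))%R by exact: fine_ge0.
pose m1 := mrestr P mB.
pose m2 := mscale (NngNum PB0) P.
have /(_ A sGA) : forall E, <<s G >> E -> m1 E = m2 E.
  apply: (g_sigma_algebra_measure_unique G Gm (fun=> setT)) => //.
  - by rewrite bigcup_const.
  - move=> C GC; transitivity (P C * P B); first exact: GH.
    rewrite /= /mscale/=.
    by rewrite fineK ?fin_num_measure// muleC.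
  - by move=> _; apply: le_lt_trans (ltry 1); apply: probability_le1; exact: measurableI.
move=> m12; transitivity (m2 A); first exact: m12.
by rewrite /m2 /mscale/= fineK ?fin_num_measure// muleC.
Qed.

Lemma sub_gen_sigma_measurable (G : set (set T)) :
  G `<=` measurable -> <<s G >> `<=` measurable.
Proof. by move=> Gm; apply: smallest_sub => //; exact: sigma_algebra_measurable. Qed.

Lemma independent_gen_sigma G H : G `<=` measurable -> H `<=` measurable ->
  setI_closed G -> setI_closed H -> G setT -> H setT ->
  independent_systems G H -> independent_systems <<s G >> <<s H >>.
Proof.
move=> Gm Hm GI HI GT HT GH.
apply: independent_gen_sigma_l => //; first exact: sub_gen_sigma_measurable.
apply: independent_systemsC; apply: independent_gen_sigma_l => //.
exact: independent_systemsC.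
Qed.

End IndependentSigmaAlgebras.

(** * Fubini for two independent sigma-algebras on one space *)

Section Freezing.
Context {d : measure_display} {T : measurableType d} {R : realType}.
Variable P : probability T R.
Variables G H : set (set T).
Hypotheses (Gm : G `<=` measurable) (Hm : H `<=` measurable).
Hypotheses (GI : setI_closed G) (HI : setI_closed H) (GT : G setT) (HT : H setT).
Hypothesis GH : independent_systems P G H.
Local Open Scope ereal_scope.

Local Notation TG := (g_sigma_algebraType G).
Local Notation TH := (g_sigma_algebraType H).

(** [TG] and [TH] have the carrier of [T] but coarser sigma-algebras; the identity, seen as a
    measurable map into each, transports P to its restriction. *)
Let idG : T -> TG := fun w => w.
Let idH : T -> TH := fun w => w.

Let midG : measurable_fun setT idG.
Proof. by move=> _ A mA; rewrite setTI; exact: (sub_gen_sigma_measurable Gm). Qed.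
Let midH : measurable_fun setT idH.
Proof. by move=> _ A mA; rewrite setTI; exact: (sub_gen_sigma_measurable Hm). Qed.

HB.instance Definition _ := isMeasurableFun.Build _ _ _ _ idG midG.
HB.instance Definition _ := isMeasurableFun.Build _ _ _ _ idH midH.

Let PG : probability TG R := distribution P idG.
Let PH : probability TH R := distribution P idH.

(* Independence of the two sigma-algebras says exactly that the diagonal pushes [P]
   forward to a product measure; Fubini then freezes the first coordinate. *)
Let diag : T -> TG * TH := fun w => (w, w).
Let mdiag : measurable_fun setT diag.
Proof. exact: measurable_fun_pair. Qed.
HB.instance Definition _ := isMeasurableFun.Build _ _ _ _ diag mdiag.

Let pushforward_diag (X : set (TG * TH)) : measurable X ->
  pushforward P diag X = (PG \x PH) X.
Proof.
move=> mX; apply/esym; apply: product_measure_unique => // A B mA mB.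
rewrite /pushforward /PG /PH /= /distribution /pushforward.
rewrite (_ : diag @^-1` _ = A `&` B)//.
exact: (independent_gen_sigma Gm Hm GI HI GT HT GH).
Qed.

Lemma ge0_integral_freeze (f : TG * TH -> \bar R) :
  measurable_fun [set: TG * TH] f -> (forall x, 0 <= f x) ->
  \int[P]_w f (w, w) = \int[P]_w \int[P]_w' f (w, w').
Proof.
move=> mf f0.
transitivity (\int[pushforward P diag]_x f x).
  by rewrite ge0_integral_pushforward.
rewrite (eq_measure_integral (PG \x PH)); last by move=> A mA _; exact: pushforward_diag.
rewrite fubini_tonelli1// ge0_integral_pushforward//; last 2 first.
- exact: measurable_fun_fubini_tonelli_F.
- by move=> x _; apply: integral_ge0.
apply: eq_integral => w _ /=; rewrite /fubini_F ge0_integral_pushforward//.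
exact: measurable_fun_pair2.
Qed.

Lemma integral_freeze (f : TG * TH -> \bar R) :
  measurable_fun [set: TG * TH] f -> P.-integrable setT (fun w => f (w, w)) ->
  \int[P]_w f (w, w) = \int[P]_w \int[P]_w' f (w, w').
Proof.
move=> mf intf.
have intpf : (PG \x PH).-integrable setT f.
  have /integrableP[_] : (pushforward P diag).-integrable setT f.
    exact: integrable_pushforward.
  rewrite (eq_measure_integral (PG \x PH)); last first.
    by move=> A mA _; exact: pushforward_diag.
  by move=> fy; apply/integrableP.
transitivity (\int[pushforward P diag]_x f x).
  by rewrite integral_pushforward.
rewrite (eq_measure_integral (PG \x PH)); last by move=> A mA _; exact: pushforward_diag.
rewrite -integral12_prod_meas1// integral_pushforward//; last 2 first.
- exact: measurable_fubini_F intpf.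
- have /integrableP[mF] := integrable_fubini_F intpf.
  rewrite ge0_integral_pushforward//; last exact: measurableT_comp.
  by move=> Fy; apply/integrableP; split => //; exact: measurableT_comp.
apply: eq_integral => w _ /=; rewrite /fubini_F.
have mfw : measurable_fun [set: TH] (fun y : TH => f (w : TG, y)).
  exact: measurable_fun_pair2.
(* Integrability of the slice at w is known only for almost every w. The positive and negative parts
   are transported separately, which is valid for all w. *)
rewrite integralE [RHS]integralE !ge0_integral_pushforward//.
- exact: measurable_funeneg.
- exact: measurable_funepos.
Qed.
End Freezing.

(** * A strong law of large numbers for orthogonal variables *)

Lemma nat_between_squares (N : nat) : (0 < N)%N ->
  exists m, (m.+1 ^ 2 <= N <= m.+1 ^ 2 + 2 * m.+1)%N.
Proof.
elim: N => // -[_ _|N IH _]; first by exists 0%N.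
have [m /andP[m1 m2]] := IH isT.
have [m3|m3] := ltnP N.+1 (m.+1 ^ 2 + 2 * m.+1); first by exists m; rewrite m3 leqW.
exists m.+1; move: m2 m3; rewrite !expnSr !expn0; nia.
Qed.

Section StrongLaw.
Context {d : measure_display} {T : measurableType d} {R : realType}.
Variable P : probability T R.

(** By monotone convergence the sum of the series has finite expectation, so it is almost surely
    finite and its terms tend to 0. *)
Lemma ae_cvg0_of_summable_integrals (Q : nat -> T -> R) :
  (forall n, measurable_fun setT (Q n)) -> (forall n w, 0 <= Q n w) ->
  (\sum_(n <oo) \int[P]_w (Q n w)%:E < +oo)%E ->
  {ae P, forall w, Q n w @[n --> \oo] --> 0}.
Proof.
move=> mQ Q0 sQ.
have intQ : P.-integrable setT (fun w => \sum_(n <oo) (Q n w)%:E)%E.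
  apply/integrableP; split.
    apply: ge0_emeasurable_sum => //.
    - by move=> n w _ _; rewrite lee_fin.
    - by move=> n _; apply/measurable_EFinP.
  under eq_integral.
    move=> w _; rewrite gee0_abs; last by apply: nneseries_ge0 => n _ _; rewrite lee_fin.
    over.
  rewrite integral_nneseries//.
  - by move=> n; apply/measurable_EFinP.
  - by move=> n w _; rewrite lee_fin.
have := integrable_ae measurableT intQ; apply: filterS => w /(_ I) fw.
apply: cvg_series_cvg_0; apply: nondecreasing_is_cvgn.
  by apply: nondecreasing_series => n _ _; exact: Q0.
exists (fine (\sum_(n <oo) (Q n w)%:E)%E) => _ [n _ <-].
rewrite -lee_fin fineK// seriesEnat/= -sumEFin.
by apply: nneseries_lim_ge => k _ _; rewrite lee_fin.
Qed.

Lemma nneseries_lty_inv_sqr (u : nat -> \bar R) (c : R) :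
  (forall n, 0 <= u n)%E -> (forall n, u n <= (c / n.+1%:R ^+ 2)%:E)%E ->
  (\sum_(n <oo) u n < +oo)%E.
Proof.
move=> u0 uc.
have c0 : 0 <= c.
  by have := le_trans (u0 0%N) (uc 0%N); rewrite lee_fin expr1n divr1.
(* The telescoping majorant comes from 1 / x^2 <= 2 / x - 2 / (x + 1) for x >= 1, with equality at x
   = 1. *)
suff H n : (\sum_(0 <= k < n) u k <= (c * (2 - 2 / n.+1%:R))%:E)%E.
  apply: (@le_lt_trans _ _ (c * 2)%:E); last exact: ltry.
  apply: lime_le; first by apply: is_cvg_nneseries => n _ _.
  apply: nearW => n; apply: le_trans (H n) _.
  by rewrite lee_fin ler_wpM2l// gerBl divr_ge0.
elim: n => [|n IHn]; first by rewrite big_nil lee_fin divr1 subrr mulr0.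
rewrite big_nat_recr//=; apply: le_trans (leeD IHn (uc n)) _.
rewrite -EFinD lee_fin -mulrDr ler_wpM2l//.
rewrite -[in n.+2%:R]addn1 natrD.
have n0 : 1 <= n.+1%:R :> R by rewrite ler1n.
move: (n.+1%:R : R) n0 => x x1.
have x0 : 0 < x by lra.
have x10 : 0 < x + 1 by lra.
rewrite -subr_ge0.
have -> : 2 - 2 / (x + 1) - (2 - 2 / x + (x ^+ 2)^-1)
   = (x - 1) / (x ^+ 2 * (x + 1)) by field; lra.
by rewrite divr_ge0 ?mulr_ge0 ?exprn_ge0//; lra.
Qed.

(** Disposes of the boundary terms that telescoping sums leave behind. *)
Lemma ae_cvg0_div_index (X : nat -> T -> R) (c : R) :
  (forall n, measurable_fun setT (X n)) ->
  (forall n, \int[P]_w (X n w ^+ 2)%:E <= c%:E)%E ->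
  {ae P, forall w, X n w / n.+1%:R @[n --> \oo] --> 0}.
Proof.
move=> mX Xc.
have : {ae P, forall w, (X n w / n.+1%:R) ^+ 2 @[n --> \oo] --> 0}.
  apply: ae_cvg0_of_summable_integrals.
  - by move=> n; apply: measurable_funX; apply: measurable_funM.
  - by move=> n w; rewrite sqr_ge0.
  apply: (nneseries_lty_inv_sqr (c := c)) => n.
    by apply: integral_ge0 => w _; rewrite lee_fin sqr_ge0.
  under eq_integral do rewrite expr_div_n mulrC EFinM.
  rewrite ge0_integralZl_EFin//.
  - by rewrite mulrC EFinM lee_wpmul2l// lee_fin invr_ge0 exprn_ge0.
  - by move=> w _; rewrite lee_fin sqr_ge0.
  - by apply/measurable_EFinP; exact: measurable_funX.
apply: filterS => w h.
apply/norm_cvg0P.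
have := continuous_cvg _ (@sqrt_continuous R 0) h.
rewrite sqrtr0 /comp; under eq_fun do rewrite sqrtr_sqr.
exact.
Qed.


Lemma integrable_mul_of_sqr (f g : T -> R) :
  measurable_fun setT f -> measurable_fun setT g ->
  P.-integrable setT (fun w => (f w ^+ 2)%:E) ->
  P.-integrable setT (fun w => (g w ^+ 2)%:E) ->
  P.-integrable setT (fun w => (f w * g w)%:E).
Proof.
move=> mf mg f2 g2; apply: le_integrable (integrableD measurableT f2 g2) => //.
  by apply/measurable_EFinP; exact: measurable_funM.
move=> w _ /=; rewrite lee_fin [leRHS]ger0_norm ?addr_ge0 ?sqr_ge0//.
rewrite ler_norml; apply/andP; split; nra.
Qed.

Variables (xi : nat -> T -> R) (K : R).
Hypothesis mxi : forall j, measurable_fun setT (xi j).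
Hypothesis xiK : forall j, (\int[P]_w (xi j w ^+ 2)%:E <= K%:E)%E.
Hypothesis xi_orth : forall i j, (i < j)%N ->
  (\int[P]_w (xi i w * xi j w)%:E = 0)%E.

Let int_sqr j : P.-integrable setT (fun w => (xi j w ^+ 2)%:E).
Proof.
apply/integrableP; split; first by apply/measurable_EFinP; exact: measurable_funX.
under eq_integral do rewrite gee0_abs ?lee_fin ?sqr_ge0//.
exact: le_lt_trans (xiK j) (ltry _).
Qed.

Let int_mul i j : P.-integrable setT (fun w => (xi i w * xi j w)%:E).
Proof. exact: integrable_mul_of_sqr. Qed.

Let S a n w := \sum_(a <= j < a + n) xi j w.

Let mS a n : measurable_fun setT (S a n).
Proof. exact: measurable_sum. Qed.

Let SS a n w : S a n.+1 w = S a n w + xi (a + n)%N w.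
Proof. by rewrite /S addnS big_nat_recr// leq_addr. Qed.

(** Orthogonality kills the cross terms, so the second moment of a block sum is at most linear in
    its length. *)
Let S_sqr a n : P.-integrable setT (fun w => (S a n w ^+ 2)%:E) /\
  (\int[P]_w (S a n w ^+ 2)%:E <= (K * n%:R)%:E)%E.
Proof.
elim: n => [|n [IHi IHn]].
  have -> : (fun w => (S a 0 w ^+ 2)%:E) = cst 0%E.
    by apply/funext => w; rewrite /S addn0 big_geq// expr0n.
  by rewrite integral0 mulr0; split => //; exact: integrable0.
have SxiE : (fun w => (S a n w * xi (a + n)%N w)%:E) =
    (fun w => \sum_(a <= j < a + n) (xi j w * xi (a + n)%N w)%:E)%E.
  by apply/funext => w; rewrite /S mulr_suml sumEFin.
have iSxi : P.-integrable setT (fun w => (S a n w * xi (a + n)%N w)%:E).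
  by rewrite SxiE; apply: integrable_sum => // j _.
have Sxi0 : (\int[P]_w (S a n w * xi (a + n)%N w)%:E = 0)%E.
  rewrite SxiE integral_sum//.
  by rewrite big_nat big1// => j /andP[_ jn]; exact: xi_orth.
have E w : ((S a n.+1 w) ^+ 2)%:E =
    ((S a n w ^+ 2)%:E + 2%:E * (S a n w * xi (a + n)%N w)%:E
       + (xi (a + n)%N w ^+ 2)%:E)%E.
  by rewrite SS -EFinM -!EFinD; congr EFin; ring.
have i2 := integrableZl measurableT 2 iSxi.
under eq_fun do rewrite E.
split; first by apply: integrableD => //; apply: integrableD.
rewrite integralD//; last exact: integrableD.
rewrite integralD// integralZl// Sxi0 mule0 adde0.
rewrite -natr1 mulrDr mulr1 EFinD; exact: leeD.
Qed.

(* Controls all the averages with index between [m.+1 ^ 2] and [m.+2 ^ 2]; its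
   expectation is [O(m^-2)], hence summable. *)
Let Q m w : R := (S 0 (m.+1 ^ 2) w ^+ 2 +
  \sum_(0 <= r < (2 * m.+1).+1) S (m.+1 ^ 2) r w ^+ 2) / m.+1%:R ^+ 4.

Let Q0 : {ae P, forall w, Q n w @[n --> \oo] --> 0}.
Proof.
have K0 : 0 <= K.
  rewrite -lee_fin; apply: le_trans (xiK 0%N).
  by apply: integral_ge0 => w _; rewrite lee_fin sqr_ge0.
have mS2 a n : measurable_fun setT (fun w => S a n w ^+ 2) by exact: measurable_funX.
have sum0 m w : 0 <= \sum_(0 <= r < (2 * m.+1).+1) S (m.+1 ^ 2) r w ^+ 2.
  by apply: sumr_ge0 => r _; rewrite sqr_ge0.
have num0 m w : 0 <= S 0 (m.+1 ^ 2) w ^+ 2 +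
    \sum_(0 <= r < (2 * m.+1).+1) S (m.+1 ^ 2) r w ^+ 2.
  by rewrite addr_ge0// sqr_ge0.
apply: ae_cvg0_of_summable_integrals.
- by move=> m; apply: measurable_funM => //; apply: measurable_funD => //; exact: measurable_sum.
- by move=> m w; rewrite divr_ge0// exprn_ge0.
apply: (nneseries_lty_inv_sqr (c := 10 * K)) => m.
  by apply: integral_ge0 => w _; rewrite lee_fin divr_ge0// exprn_ge0.
under eq_integral do rewrite /Q mulrC EFinM.
rewrite ge0_integralZl_EFin//; last 2 first.
- by move=> w _; rewrite lee_fin.
- by apply/measurable_EFinP; apply: measurable_funD => //; exact: measurable_sum.
have m1 : 1 <= m.+1%:R :> R by rewrite ler1n.
apply: (@le_trans _ _ ((m.+1%:R ^+ 4)^-1%:E * (10 * K * m.+1%:R ^+ 2)%:E)%E); last first.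
  rewrite -EFinM lee_fin mulrC.
  move: (m.+1%:R : R) m1 => x x1.
  have -> : 10 * K * x ^+ 2 / x ^+ 4 = 10 * K / x ^+ 2 by field; lra.
  by [].
rewrite lee_wpmul2l ?lee_fin ?invr_ge0 ?exprn_ge0//.
under eq_integral do rewrite EFinD.
rewrite ge0_integralD//; last 4 first.
- by move=> w _; rewrite lee_fin sqr_ge0.
- exact/measurable_EFinP.
- by move=> w _; rewrite lee_fin.
- by apply/measurable_EFinP; exact: measurable_sum.
have [_ h1] := S_sqr 0 (m.+1 ^ 2).
apply: (@le_trans _ _ ((K * (m.+1 ^ 2)%:R)%:E + (9 * K * m.+1%:R ^+ 2)%:E)%E); last first.
  by rewrite -EFinD lee_fin natrX; lra.
apply: leeD => //.
under eq_integral do rewrite -sumEFin.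
rewrite ge0_integral_sum//; last 2 first.
- by move=> r; exact/measurable_EFinP.
- by move=> r w _; rewrite lee_fin sqr_ge0.
(* There are 2 (m + 1) + 1 <= 3 (m + 1) block sums, each of length at most 3 (m + 1), whence the 9;
   the initial sum up to the square raises it to the 10 above. *)
apply: (@le_trans _ _ (\sum_(0 <= r < (2 * m.+1).+1) (K * (3 * m.+1%:R))%:E)%E).
  rewrite !big_nat; apply: lee_sum => r /andP[_ rm].
  have [_ h2] := S_sqr (m.+1 ^ 2) r; apply: le_trans h2 _.
  rewrite lee_fin ler_wpM2l// -natrM ler_nat.
  by rewrite (leq_trans (ltnW rm))// !mulSn; lia.
rewrite sumEFin lee_fin sumr_const_nat subn0 -[leLHS]mulr_natr.
rewrite -[((2 * m.+1).+1)%:R]natr1 natrM.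
move: (m.+1%:R : R) m1 => x x1; rewrite -subr_ge0.
have -> : 9 * K * x ^+ 2 - K * (3 * x) * (2 * x + 1) = 3 * K * x * (x - 1) by ring.
by rewrite !mulr_ge0//; lra.
Qed.

(** Between consecutive squares a block has length of order sqrt N, so bounding one squared block
    sum by the sum of them all is affordable and replaces a maximal inequality. *)
Lemma strong_law_orthogonal :
  {ae P, forall w, (\sum_(0 <= j < n) xi j w) / n.+1%:R @[n --> \oo] --> 0}.
Proof.
apply: filterS Q0 => w Qw.
apply/cvgrPdist_lt => e e0.
(* Half of e^2, because (a + b)^2 <= 2 (a^2 + b^2) costs a factor 2 when the sum up to N is split at
   the last square. *)
have e2 : 0 < e ^+ 2 / 2 by rewrite divr_gt0// exprn_gt0.
have /cvgrPdist_lt/(_ _ e2) [M _ HM] := Qw.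
exists (M.+1 ^ 2)%N => //= N /= MN.
have [m [Mm m1 m2]] : exists m,
    [/\ (M <= m)%N, (m.+1 ^ 2 <= N)%N & (N <= m.+1 ^ 2 + 2 * m.+1)%N].
  have [m /andP[m1 m2]] := nat_between_squares (leq_trans (expn_gt0 M.+1 2) MN).
  by exists m; split => //; move: m2 MN; rewrite !expnSr !expn0; nia.
have := HM _ Mm; rewrite /= !sub0r !normrN => Qe.
pose r := (N - m.+1 ^ 2)%N.
have SE : \sum_(0 <= j < N) xi j w = S 0 (m.+1 ^ 2) w + S (m.+1 ^ 2) r w.
  by rewrite /S add0n subnKC// -big_cat_nat.
have Sr : S (m.+1 ^ 2) r w ^+ 2 <=
    \sum_(0 <= i < (2 * m.+1).+1) S (m.+1 ^ 2) i w ^+ 2.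
  rewrite (bigD1_seq r) ?mem_index_iota ?iota_uniq//=; last by rewrite ltnS leq_subLR.
  by rewrite lerDl sumr_ge0// => i _; rewrite sqr_ge0.
suff : ((\sum_(0 <= j < N) xi j w) / N.+1%:R) ^+ 2 < e ^+ 2.
  by rewrite -[ltLHS]real_normK ?num_real// ltr_pXn2r ?nnegrE// ltW.
apply: (@le_lt_trans _ _ (2 * Q m w)); last first.
  by have := le_lt_trans (ler_norm _) Qe; lra.
rewrite expr_div_n ler_pdivrMr ?exprn_gt0//.
have Nm : m.+1%:R ^+ 2 <= N.+1%:R :> R by rewrite -natrX ler_nat ltnW.
have m0 : 0 < m.+1%:R :> R by [].
have hN : m.+1%:R ^+ 4 <= N.+1%:R ^+ 2 :> R.
  by rewrite (_ : 4 = 2 * 2)%N// exprM lerXn2r ?nnegrE ?exprn_ge0.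
rewrite {}SE /Q mulrA mulrAC ler_pdivlMr ?exprn_gt0//.
set a := S 0 _ w; set b := S _ r w.
rewrite -/b in Sr.
move: (\sum_(0 <= i < _) _) Sr => s Sr.
apply: (@le_trans _ _ ((a + b) ^+ 2 * N.+1%:R ^+ 2)); first by rewrite ler_wpM2l ?sqr_ge0.
rewrite ler_wpM2r ?sqr_ge0//; apply: (@le_trans _ _ (2 * (a ^+ 2 + b ^+ 2))); last by lra.
rewrite -subr_ge0; have -> : 2 * (a ^+ 2 + b ^+ 2) - (a + b) ^+ 2 = (a - b) ^+ 2 by ring.
exact: sqr_ge0.
Qed.

End StrongLaw.

(** * Integration against the exponential law *)

Lemma is_derive_mul {R : realType} (f g : R -> R) (x a b : R) :
  is_derive x 1 f a -> is_derive x 1 g b ->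
  is_derive x 1 (fun t => f t * g t) (f x * b + g x * a).
Proof. by move=> df dg; exact: is_deriveM. Qed.

Lemma is_derive_expR_scale {R : realType} (k x : R) :
  is_derive x 1 (fun t => expR (k * t)) (k * expR (k * x)).
Proof.
have d1 : is_derive x 1 (fun t : R => k * t) k.
  by apply: is_derive_eq; rewrite /GRing.scale/= mulr1.
by rewrite mulrC; exact: is_derive1_comp (is_derive_expR _) d1.
Qed.

Lemma is_derive_continuous {R : realType} (f df : R -> R) :
  (forall x : R, is_derive x 1 f (df x)) -> continuous f.
Proof.
move=> fd x; apply/differentiable_continuous/derivable1_diffP.
by have [] := fd x.
Qed.

Section ExponentialVariable.
Context {d : measure_display} {T : measurableType d} {R : realType}.
Variables (P : probability T R) (A : T -> R) (lambda : R).
Hypotheses (lambda0 : 0 < lambda) (mA : measurable_fun setT A).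
Hypothesis A_cdf : forall s, 0 <= s ->
  P [set w | A w <= s] = (1 - expR (- lambda * s))%:E.
Notation mu := (@lebesgue_measure R).

Let pdf (a : R) : R := lambda * expR (- lambda * a).

Let pdf_ge0 a : 0 <= pdf a.
Proof. by rewrite mulr_ge0 ?expR_ge0// ltW. Qed.

Let cpdf : continuous pdf.
Proof.
by apply: is_derive_continuous => x; exact: is_derive_mul.
Qed.

Let mpdf (D : set R) : measurable_fun D (EFin \o pdf).
Proof. by apply/measurable_EFinP/measurable_funTS; exact: continuous_measurable_fun. Qed.

Let law (E : set (measurableTypeR R)) : \bar R :=
  (\int[mu]_(a in E `&` `[0%R, +oo[) (pdf a)%:E)%E.

Let law0 : law set0 = 0%E.
Proof. by rewrite /law set0I integral_set0. Qed.

Let law_ge0 E : (0 <= law E)%E.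
Proof. by apply: integral_ge0 => a _; rewrite lee_fin. Qed.

Let law_sigma_additive : semi_sigma_additive law.
Proof.
move=> F mF tF mUF; rewrite /law; apply: cvg_toP.
  apply: ereal_nondecreasing_is_cvgn => m n mn.
  by apply: lee_sum_nneg_natr => // k _ _; apply: integral_ge0 => a _; rewrite lee_fin.
rewrite setI_bigcupl ge0_integral_bigcup//=.
- by move=> k; exact: measurableI.
- exact: mpdf.
- by move=> a _; rewrite lee_fin.
- exact: trivIset_setIr.
Qed.

HB.instance Definition _ := isMeasure.Build _ _ _ law law0 law_ge0 law_sigma_additive.

(** The equation for F says that a |-> - F a * expR (- lambda * a) is an antiderivative of the
    integrand; the growth condition removes the boundary term at infinity. *)
Lemma integral_exp_tail (h F : R -> R) (s : R) :
  (forall a, s <= a -> 0 <= h a) -> continuous h ->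
  (forall a : R, is_derive a 1 F (lambda * (F a - h a))) ->
  F a * expR (- lambda * a) @[a --> +oo] --> 0 ->
  (\int[mu]_(a in `[s, +oo[) (h a * (lambda * expR (- lambda * a)))%:E =
   (F s * expR (- lambda * s))%:E)%E.
Proof.
move=> h0 ch dF Fy.
have dG (x : R) : is_derive x 1 (fun a => - (F a * expR (- lambda * a))) (h x * pdf x).
  have -> : h x * pdf x = - (F x * (- lambda * expR (- lambda * x)) +
      expR (- lambda * x) * (lambda * (F x - h x))) by rewrite /pdf; ring.
  exact: is_deriveN (is_derive_mul (dF x) (is_derive_expR_scale _ _)).
rewrite (@ge0_continuous_FTC2y _ _ (fun a => - (F a * expR (- lambda * a))) _ 0)//.
- by rewrite -EFinB sub0r opprK.
- by move=> x /h0 hx; exact: mulr_ge0 hx (pdf_ge0 x).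
- by apply: continuous_subspaceT => x; apply: cvgM; [exact: ch|exact: cpdf].
- by rewrite -oppr0; apply: cvgN.
- by apply: cvg_at_right_filter; exact: (is_derive_continuous dG).
- by move=> x _; rewrite derive1E; have [_ ->] := dG x.
Qed.

Lemma cvg0_mul_expR (c k : R) : k < lambda ->
  c * expR (k * a) * expR (- lambda * a) @[a --> +oo] --> 0.
Proof.
move=> kl.
have -> : (fun a => c * expR (k * a) * expR (- lambda * a)) =
    (fun a => c * expR (- ((lambda - k) * a))).
  by apply/funext => a; rewrite -mulrA -expRD; congr (_ * expR _); ring.
rewrite -(mulr0 c); apply: cvgM; first exact: cvg_cst.
apply: (@cvg_comp _ _ _ (fun a => (lambda - k) * a) (fun y => expR (- y)) _
  (pinfty_nbhs R)); last exact: cvgr_expR.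
by apply: gt0_cvgMry => //; rewrite subr_gt0.
Qed.

Let integral_pdf (s : R) : (\int[mu]_(a in `[s, +oo[) (pdf a)%:E = (expR (- lambda * s))%:E)%E.
Proof.
have d1 (a : R) : is_derive a 1 (cst 1 : R -> R) (lambda * (cst 1 a - cst 1 a)).
  by rewrite subrr mulr0; exact: is_derive_cst.
have cst1 : continuous (cst 1 : R -> R) by move=> a; exact: cvg_cst.
have := @integral_exp_tail (cst 1) (cst 1) s (fun _ _ => ler01) cst1 d1.
rewrite mul1r => <-; first by apply: eq_integral => a _; rewrite mul1r.
by have := cvg0_mul_expR 1 lambda0; under eq_fun do rewrite mul0r expR0 mulr1.
Qed.

Let A' : T -> measurableTypeR R := A.
Let mA' : measurable_fun setT A'. Proof. exact: mA. Qed.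
HB.instance Definition _ := isMeasurableFun.Build _ _ _ _ A' mA'.

Let lawE (E : set (measurableTypeR R)) : measurable E -> pushforward P A' E = law E.
Proof.
move=> mE.
apply: (@measure_unique _ R (measurableTypeR R) (@RGenOInfty.G R)
  (fun n => `](- n%:R : R), +oo[%classic) _ _ _ _ (distribution P A') law) => //.
- exact: RGenOInfty.measurableE.
- move=> _ _ [x ->] [y ->]; exists (Num.max x y); apply/seteqP; split => z /=.
    by rewrite !in_itv/= !andbT gt_max => -[-> ->].
  by rewrite !in_itv/= !andbT gt_max => /andP.
- by move=> n; exists (- n%:R).
- rewrite -subTset => x _; exists (Num.truncn (- x : R)).+1 => //=.
  by rewrite in_itv/= andbT ltrNl truncnS_gt.
- move=> _ [x ->].
  rewrite /= /distribution /pushforward (_ : A' @^-1` _ = ~` [set w | A w <= x]); last first.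
    by apply/seteqP; split => w /=; rewrite in_itv/= andbT; rewrite ltNge => /negP.
  rewrite probability_setC; last by rewrite -[X in measurable X]setTI; exact: measurable_fun_le.
  have [x0|x0] := leP 0 x.
    rewrite A_cdf// /law (_ : _ `&` _ = `]x, +oo[%classic); last first.
      apply/setIidl => a /=; rewrite !in_itv/= !andbT => xa; exact: le_trans (ltW xa).
    by rewrite integral_itv_obnd_cbnd// integral_pdf -EFinB; congr EFin; ring.
  (* For x < 0 the distribution function is not prescribed, but its value 0 at 0 shows that no mass
     lies at or below 0. *)
  rewrite /law (_ : _ `&` _ = `[0, +oo[%classic); last first.
    apply/setIidr => a /=; rewrite !in_itv/= !andbT; exact: lt_le_trans.
  rewrite integral_pdf mulr0 expR0 (_ : P _ = 0%E) ?sube0//.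
  apply/eqP; rewrite eq_le measure_ge0 andbT.
  have -> : 0%E = P [set w | A w <= 0] by rewrite A_cdf// mulr0 expR0 subrr.
  apply: le_measure; rewrite ?inE.
  - by rewrite -[X in measurable X]setTI; exact: measurable_fun_le.
  - by rewrite -[X in measurable X]setTI; exact: measurable_fun_le.
  - by move=> w /= /le_trans; apply; exact: ltW.
- move=> n; apply: le_lt_trans (ltry 1); exact: probability_le1.
Qed.

Lemma ge0_integral_exponential (g : R -> \bar R) :
  measurable_fun setT g -> (forall a, 0 <= g a)%E ->
  (\int[P]_w g (A w) = \int[mu]_(a in `[0%R, +oo[) (g a * (pdf a)%:E))%E.
Proof.
move=> mg g0.
pose nu := distribution P A'.
have numu : nu `<< mu.
  apply/null_content_dominatesP => E mE E0; rewrite /nu /distribution lawE//.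
  rewrite /law; apply: null_set_integral => //; first exact: measurableI.
    exact: mpdf.
  apply: (subset_measure0 (B := E)) => //; exact: measurableI.
transitivity (\int[nu]_a g a)%E; first by rewrite ge0_integral_pushforward.
rewrite -(Radon_Nikodym_SigmaFinite.change_of_variables numu)//.
pose f : measurableTypeR R -> \bar R := (EFin \o pdf) \_ `[0, +oo[.
have mf : measurable_fun setT f.
  by apply: (measurable_restrictT (EFin \o pdf) _).1 => //; exact: mpdf.
transitivity (\int[mu]_a (g a * f a))%E; last first.
  rewrite [RHS]integral_mkcond; apply: eq_integral => a _.
  by rewrite /f !patchE; case: ifPn => // _; rewrite mule0.
have mRN : measurable_fun setT (Radon_Nikodym_SigmaFinite.f nu mu).
  exact: measurable_int (Radon_Nikodym_SigmaFinite.f_integrable numu).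
apply: ae_eq_integral => //; [exact: emeasurable_funM|exact: emeasurable_funM|].
(* The Radon-Nikodym derivative and the truncated density have the same integral over every
   measurable set, hence coincide almost everywhere. *)
apply: ae_eqe_mul2l; apply: integral_ae_eq => //.
  exact: Radon_Nikodym_SigmaFinite.f_integrable.
move=> E _ mE; rewrite -(Radon_Nikodym_SigmaFinite.f_integral numu)//.
by rewrite /nu /= /distribution lawE// /law integral_mkcondr.
Qed.

(* Solving [F' = lambda (F - h)] and integrating by parts turns the integral of
   [h] against the exponential density into a boundary value of [F]. *)
Lemma integral_exponential_shift (h F : R -> R) (c k z : R) :
  (forall y, 0 <= y -> 0 <= h y) -> continuous h ->
  (forall y : R, is_derive y 1 F (lambda * (F y - h y))) ->
  k < lambda -> (forall y, 0 <= y -> `|F y| <= c * expR (k * y)) ->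
  (\int[P]_w (if 0 <= z + A w then h (z + A w) else 0)%:E =
   (F (Num.max z 0) * expR (- lambda * Num.max (- z) 0))%:E)%E.
Proof.
move=> h0 ch dF kl Fc.
have mh : measurable_fun setT h by exact: continuous_measurable_fun.
have mshift : measurable_fun setT (fun a : R => z + a) by exact: measurable_funD.
pose g a := (if 0 <= z + a then h (z + a) else 0)%:E.
have g0 a : (0 <= g a)%E by rewrite /g; case: ifPn => //; rewrite lee_fin => /h0.
have mg : measurable_fun setT g.
  apply/measurable_EFinP; apply: measurable_fun_ifT => //.
  - exact: measurable_fun_ler.
  - exact: measurableT_comp.
rewrite (ge0_integral_exponential mg g0).
pose s : R := Num.max (- z) 0; rewrite -/s.
have sub : `[s, +oo[%classic `<=` (`[0, +oo[%classic : set R).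
  by move=> a /=; rewrite !in_itv/= !andbT ge_max => /andP[].
transitivity (\int[mu]_(a in `[s, +oo[) (h (z + a) * pdf a)%:E)%E.
  rewrite -(setIidr sub) [RHS]integral_mkcondr; apply: eq_integral => a; rewrite inE/=.
  rewrite in_itv/= andbT => a0; rewrite patchE /g.
  have -> : (a \in `[s, +oo[%classic) = (0 <= z + a).
    by rewrite mem_setE in_itv/= andbT ge_max a0 andbT -subr_ge0 opprK addrC.
  by case: ifPn => // _; rewrite mul0e.
have sz : z + s = Num.max z 0 by rewrite /s; case: (leP z 0) => ?; case: leP => ?; lra.
have dFz (a : R) : is_derive a 1 (fun a => F (z + a)) (lambda * (F (z + a) - h (z + a))).
  rewrite -[_ * (_ - _)]mulr1.
  have d1 : is_derive a 1 (fun t : R => z + t) 1.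
    by have := is_deriveD (is_derive_cst z a 1) (is_derive_id a 1); rewrite add0r.
  exact: is_derive1_comp (dF (z + a)) d1.
rewrite -sz; apply: (integral_exp_tail (h := fun a => h (z + a)) _ _ dFz).
- by move=> a; rewrite ge_max => /andP[za _]; apply: h0; lra.
- move=> a; apply: continuous_comp; last exact: ch.
  by apply: cvgD; [exact: cvg_cst|exact: cvg_id].
(* The bound on F grows at rate k < lambda only, so the exponential density makes F (z + a) times it
   vanish at infinity. *)
- have lim := @cvg0_mul_expR (c * expR (k * z)) k kl.
  apply/norm_cvg0P.
  apply: (squeeze_cvgr _ (cvg_cst 0) lim).
  near=> a; rewrite normr_ge0/= normrM (ger0_norm (expR_ge0 _)) ler_wpM2r ?expR_ge0//.
  rewrite -mulrA -expRD -mulrDr; apply: Fc.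
  rewrite -lerBlDl sub0r; near: a; apply: nbhs_pinfty_ge; exact: num_real.
Unshelve. all: by end_near. Qed.

End ExponentialVariable.

(** * The sample path of the age and the area below it *)

Section SamplePath.
Context {R : realType} {n : nat}.
Variables (k : nat) (len : 'I_n -> nat).
Variables (A : nat -> R) (X : nat -> 'I_n) (C : nat -> bool).

Local Notation free_at := (free_at k len A X C).
Local Notation arrival := (arrival A).
Local Notation selected := (selected k X C).
Local Notation sent := (sent k len A X C).
Local Notation age := (age k len A X C).
Local Notation last_gen := (last_gen k len A X C).

Definition codelen (j : nat) : R := (len (X j))%:R.

(* Signed offset of the previous arrival from the end of the last transmission:
   the elapsed idle time when positive, minus the residual service when
   negative. *)
Fixpoint lag (j : nat) : R :=
  if j is i.+1 then
    if (0 <= lag i + A i) && selected i then - codelen i else lag i + A i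
  else 0.

Fixpoint last_len (j : nat) : R :=
  if j is i.+1 then
    if (0 <= lag i + A i) && selected i then codelen i else last_len i
  else 0.

Lemma arrival_lag j : arrival j = free_at j + (lag j + A j).
Proof.
elim: j => [|j IH]; first by rewrite /arrival big_ord_recl big_ord0/= !add0r addr0.
rewrite {1}/arrival big_ord_recr/= -/(arrival j) IH lerDl.
by case: ifPn => _; rewrite /codelen; ring.
Qed.

Lemma sent_lag j : sent j = (0 <= lag j + A j) && selected j.
Proof. by rewrite /Defs.sent arrival_lag lerDl. Qed.

Lemma codelen_ge0 j : 0 <= codelen j. Proof. by rewrite /codelen. Qed.

Lemma last_len_ge0 j : 0 <= last_len j.
Proof. by elim: j => //= j IH; case: ifPn. Qed.

Lemma free_atS j : free_at j.+1 =
  free_at j + (if sent j then lag j + A j + codelen j else 0).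
Proof.
rewrite /= -/(sent j); case: ifPn => _; last by rewrite addr0.
by rewrite arrival_lag /codelen; ring.
Qed.

Lemma free_at_nd : {homo free_at : i j / (i <= j)%N >-> i <= j}.
Proof.
apply: homo_leq => [x|y x z|j]; [exact: lexx|exact: le_trans|].
rewrite free_atS lerDl; case: ifPn => //; rewrite sent_lag => /andP[y0 _].
by rewrite addr_ge0// codelen_ge0.
Qed.

(** Generation time of the latest packet sent before packet j: its transmission ends at [free_at j]
    and lasts [last_len j]. Both start at 0, which matches the default 0 in [last_gen]. *)
Let gen j := free_at j - last_len j.

Let genS j : gen j.+1 = if sent j then arrival j else gen j.
Proof.
rewrite /gen free_atS /= -sent_lag; case: ifPn => _; last by rewrite addr0.
by rewrite arrival_lag; ring.
Qed.

Let gen_nd : {homo gen : i j / (i <= j)%N >-> i <= j}.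
Proof.
apply: homo_leq => [x|y x z|j]; [exact: lexx|exact: le_trans|].
rewrite genS; case: ifPn => // sj; move: (sj); rewrite sent_lag => /andP[y0 _].
by rewrite arrival_lag /gen; have := last_len_ge0 j; lra.
Qed.

Let gen_mem j : gen j = 0 \/ exists2 i, (i < j)%N & sent i /\ gen j = arrival i.
Proof.
elim: j => [|j IH]; first by left; rewrite /gen/= subrr.
rewrite genS; case: ifPn => sj; first by right; exists j.
case: IH => [->|[i ij [si gi]]]; [by left|right; exists i => //].
exact: ltnW.
Qed.

Lemma last_gen_between j t : free_at j <= t < free_at j.+1 ->
  last_gen t = free_at j - last_len j.
Proof.
move=> /andP[jt tj]; rewrite -/(gen j).
have done_at i : sent i -> arrival i + (len (X i))%:R = free_at i.+1.
  by move=> si; rewrite /= -/(sent i) si.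
rewrite /Defs.last_gen; set S := (S in sup S).
have Sgen : S (gen j).
  case: (gen_mem j) => [->|[i ij [si ->]]]; [by left|right; exists i; split => //].
  by rewrite done_at//; apply: le_trans jt; exact: free_at_nd.
have ubS : ubound S (gen j).
  move=> s [->|[i [si it ->]]].
    by rewrite -[X in X <= _](_ : gen 0 = 0) ?gen_nd// /gen/= subrr.
  (* A sent packet with index i >= j is received at [free_at i.+1], no earlier than [free_at j.+1],
     hence after t. *)
  have ij : (i < j)%N.
    rewrite ltnNge; apply/negP => ji.
    move: it; rewrite done_at// leNgt => /negP; apply; apply: lt_le_trans tj _.
    exact: free_at_nd.
  by have := gen_nd ij; rewrite genS si.
apply/eqP; rewrite eq_le; apply/andP; split.
  by apply: ge_sup => //; exists (gen j).
by apply: ub_le_sup => //; exists (gen j).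
Qed.

Local Arguments Defs.free_at : simpl never.

(** Each transmission closes a trapezoid of the sawtooth: the age starts from the previous codeword
    length and grows with slope 1 through the idle time and the new transmission. *)
Definition age_area (N : nat) : R := \sum_(0 <= j < N)
  (sent j)%:R * (last_len j * (lag j + A j + codelen j)
                + (lag j + A j + codelen j) ^+ 2 / 2).

Notation mu := (@lebesgue_measure R).

Lemma integral_affine (a b c : R) : a <= b ->
  (\int[mu]_(t in `[a, b[) (t - c)%:E = (((b - c) ^+ 2 - (a - c) ^+ 2) / 2)%:E)%E.
Proof.
move=> ab; have [ab'|ba] := ltP a b; last first.
  have -> : b = a by apply/eqP; rewrite eq_le ba.
  by rewrite set_itv_ge ?bnd_simp ?ltxx// integral_set0 subrr mul0r.
have cf : continuous (fun t : R => t - c).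
  by move=> t; apply: cvgB; [exact: cvg_id|exact: cvg_cst].
have dF (t : R) : is_derive t 1 (fun t => (t - c) ^+ 2 / 2) (t - c).
  have d1 : is_derive t 1 (fun t : R => t - c) 1.
    by have := is_deriveB (is_derive_id t 1) (is_derive_cst c t 1); rewrite subr0.
  have -> : t - c = (t - c) * (t - c) * 0 + 2^-1 * ((t - c) * 1 + (t - c) * 1) by field.
  exact: is_derive_mul (is_derive_mul d1 d1) (is_derive_cst (2^-1 : R) t 1).
have cF : continuous (fun t : R => (t - c) ^+ 2 / 2).
  exact: is_derive_continuous dF.
rewrite integral_itv_bndo_bndc; last first.
  by apply/measurable_EFinP; apply: measurable_funB.
rewrite (@continuous_FTC2 _ _ (fun t => (t - c) ^+ 2 / 2))//.
- by rewrite -EFinB mulrBl.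
- exact: continuous_subspaceT.
- split; first by move=> t _; have [] := dF t.
  + by apply: cvg_at_right_filter; exact: cF.
  + by apply: cvg_at_left_filter; exact: cF.
- by move=> t _; rewrite derive1E; have [_ ->] := dF t.
Qed.

Lemma integral_age_free_at N :
  measurable_fun `[0, free_at N[ age /\
  (forall t, 0 <= t < free_at N -> 0 <= age t) /\
  (\int[mu]_(t in `[0%R, free_at N[) (age t)%:E = (age_area N)%:E)%E.
Proof.
elim: N => [|N [mN [posN intN]]].
  rewrite set_itv_ge ?bnd_simp ?ltxx//; split; first exact: measurable_fun_set0.
  split; first by move=> t /andP[/le_lt_trans h /h]; rewrite ltxx.
  by rewrite integral_set0 /age_area big_geq.
have [sN|sN] := boolP (sent N); last first.
  have -> : free_at N.+1 = free_at N by rewrite free_atS (negbTE sN) addr0.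
  by rewrite /age_area big_nat_recr//= (negbTE sN) mul0r addr0.
have f0N : 0 <= free_at N by apply: (free_at_nd (leq0n N)).
have fNS := free_at_nd (leqnSn N).
have ageE t : free_at N <= t < free_at N.+1 -> age t = t - (free_at N - last_len N).
  by move=> h; rewrite /Defs.age (last_gen_between h).
have split_itv : `[0, free_at N.+1[%classic =
    `[0, free_at N[%classic `|` `[free_at N, free_at N.+1[%classic.
  rewrite -itv_bndbnd_setU//; exact: bnd_simp.
have mS : measurable_fun `[free_at N, free_at N.+1[ age.
  have : measurable_fun `[free_at N, free_at N.+1[
      (fun t : R => t - (free_at N - last_len N)) by exact: measurable_funB.
  by apply: eq_measurable_fun => t; rewrite inE/= in_itv/= => /ageE ->.
split; first by rewrite split_itv; apply/measurable_funU.
split.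
  move=> t /andP[t0 tN]; have [tfN|fNt] := ltP t (free_at N).
    by apply: posN; rewrite t0.
  by rewrite ageE ?fNt// ; have := last_len_ge0 N; lra.
rewrite split_itv ge0_integral_setU//=; last 3 first.
- by rewrite -split_itv; apply/measurable_EFinP; rewrite split_itv; apply/measurable_funU.
- move=> t []; rewrite in_itv/= lee_fin; first exact: posN.
  by move=> tN; rewrite ageE//; have := last_len_ge0 N; lra.
- apply/disj_setPS => t /= [] /=; rewrite !in_itv/= => /andP[_ a] /andP[b _].
  by have := lt_le_trans a b; rewrite ltxx.
rewrite intN /age_area big_nat_recr//= sN mul1r EFinD; congr (_ + _)%E.
under eq_integral.
  move=> t; rewrite inE/= in_itv/= => /ageE ->; over.
rewrite integral_affine//; congr EFin.
by rewrite free_atS sN; field.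
Qed.


Lemma integral_age_between N T : free_at N <= T < free_at N.+1 ->
  ((age_area N)%:E <= \int[mu]_(t in `[0%R, T]) (age t)%:E <= (age_area N.+1)%:E)%E.
Proof.
move=> /andP[NT TN].
have [mS [posS intS]] := integral_age_free_at N.+1.
have [_ [_ intN]] := integral_age_free_at N.
have subT : `[0, T]%classic `<=` `[0, free_at N.+1[%classic.
  by move=> t /=; rewrite !in_itv/= => /andP[-> /le_lt_trans]; apply.
have subN : `[0, free_at N[%classic `<=` `[0, T]%classic.
  by move=> t /=; rewrite !in_itv/= => /andP[-> /ltW /le_trans]; apply.
rewrite -intN -intS; apply/andP; split; apply: ge0_subset_integral => //.
- apply/measurable_EFinP; exact: measurable_funS mS.
- by move=> t /subT/=; rewrite in_itv/= lee_fin => /posS.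
- exact/measurable_EFinP.
Qed.

Hypothesis free_at_unbounded : forall x : R, exists N, x < free_at N.

Lemma exists_free_at_between T : 0 <= T -> exists N, free_at N <= T < free_at N.+1.
Proof.
move=> T0; have ex : exists N, T < free_at N by exact: free_at_unbounded.
have := ex_minnP ex; case=> -[|N] TN min; first by move: TN; rewrite /= ltNge T0.
exists N; rewrite TN andbT leNgt; apply/negP => TN'.
by have := min _ TN'; rewrite ltnn.
Qed.

(** T lies anywhere in [[free_at N], [free_at N.+1][, so the area at one end has to be divided by
    the time at the other; this explains the shifted indices. *)
Lemma avg_age_cvg (D : R) :
  age_area N / free_at N.+1 @[N --> \oo] --> D ->
  age_area N.+1 / free_at N @[N --> \oo] --> D ->
  avg_age k len A X C t @[t --> +oo] --> D%:E.
Proof.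
move=> lo up.
have bounds T : 0 < T -> exists N, [/\ free_at N <= T < free_at N.+1,
    avg_age k len A X C T \is a fin_num
    & age_area N / T <= fine (avg_age k len A X C T) <= age_area N.+1 / T].
  move=> T0; have [N NT] := exists_free_at_between (ltW T0).
  exists N; have /andP[a b] := integral_age_between NT.
  have fin : (\int[mu]_(t in `[0%R, T]) (age t)%:E)%E \is a fin_num.
    by rewrite fin_numElt (lt_le_trans (ltNyr _) a) (le_lt_trans b (ltry _)).
  split => //; first by rewrite /avg_age fin_numM.
  rewrite /avg_age fineM//= ![_ / T]mulrC !ler_pM2l ?invr_gt0//.
  by rewrite -!lee_fin fineK// a.
have area_ge0 N : 0 <= age_area N.
  apply: sumr_ge0 => j _; rewrite /= sent_lag.
  case: andP => [[y0 _]|_]; last by rewrite mul0r.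
  have := codelen_ge0 j; have := last_len_ge0 j => l0 c0.
  have h := addr_ge0 y0 c0; rewrite mul1r.
  by apply: addr_ge0; [exact: mulr_ge0|rewrite divr_ge0// sqr_ge0].
apply/fine_cvgP; split.
  near=> T; have T0 : 0 < T by near: T; exact: nbhs_pinfty_gt.
  by have [N []] := bounds T T0.
apply/cvgrPdist_lt => e e0.
have /cvgrPdist_lt/(_ _ e0)[M1 _ H1] := lo.
have /cvgrPdist_lt/(_ _ e0)[M2 _ H2] := up.
have [M0 H0] := free_at_unbounded 0.
near=> T.
have T0 : 0 < T by near: T; exact: nbhs_pinfty_gt.
have [N [/andP[NT TN] _ /andP[a b]]] := bounds T T0.
(* A large T forces a large N: otherwise monotonicity gives T < [free_at N.+1] <=
   [free_at (maxn ...)] <= T. *)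
have MN : (maxn M0 (maxn M1 M2) <= N)%N.
  rewrite -ltnS ltnNge; apply/negP => /free_at_nd NM.
  have : free_at (maxn M0 (maxn M1 M2)) <= T.
    by near: T; apply: nbhs_pinfty_ge; exact: num_real.
  by rewrite leNgt => /negP; apply; exact: lt_le_trans TN NM.
move: MN; rewrite !geq_max => /and3P[N0 N1 N2].
have fN0 : 0 < free_at N by apply: lt_le_trans H0 _; exact: free_at_nd.
have fS0 : 0 < free_at N.+1 by apply: lt_trans T0 TN.
have := H1 _ N1; rewrite /= ltr_distlC => /andP[lo1 _].
have := H2 _ N2; rewrite /= ltr_distlC => /andP[_ up2].
rewrite ltr_distlC; apply/andP; split.
  apply: lt_le_trans lo1 (le_trans _ a).
  by rewrite ler_wpM2l// lef_pV2 ?posrE// ltW.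
apply: le_lt_trans (le_trans b _) up2.
by rewrite ler_wpM2l// lef_pV2 ?posrE.
Unshelve. all: by end_near. Qed.

End SamplePath.

(** * Sequences whose averages tend to zero *)

Section AveragesToZero.
Context {R : realType}.
Implicit Types u v : nat -> R.

Definition avg0 u := (\sum_(0 <= j < N) u j) / N.+1%:R @[N --> \oo] --> 0.

Lemma eq_avg0 u v : (forall j, u j = v j) -> avg0 u -> avg0 v.
Proof. by move=> /funext ->. Qed.

Lemma avg0D u v : avg0 u -> avg0 v -> avg0 (fun j => u j + v j).
Proof.
move=> hu hv; rewrite /avg0 -[X in _ --> X]addr0.
under eq_fun do rewrite big_split/= mulrDl.
exact: cvgD.
Qed.

Lemma avg0Z c u : avg0 u -> avg0 (fun j => c * u j).
Proof.
move=> hu; rewrite /avg0 -[X in _ --> X](mulr0 c).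
under eq_fun do rewrite -mulr_sumr -mulrA.
by apply: cvgM => //; exact: cvg_cst.
Qed.

Lemma avg0_telescope u : u N / N.+1%:R @[N --> \oo] --> 0 ->
  avg0 (fun j => u j - u j.+1).
Proof.
move=> hu; rewrite /avg0.
have -> : (fun N => (\sum_(0 <= j < N) (u j - u j.+1)) / N.+1%:R) =
    (fun N => u 0%N * N.+1%:R^-1 - u N / N.+1%:R).
  apply/funext => N; rewrite -mulrBl; congr (_ / _).
  by rewrite -[LHS]opprK -sumrN; under eq_bigr do rewrite opprB; rewrite telescope_sumr// opprB.
rewrite -[X in _ --> X]subr0 -[X in _ --> X - _](mulr0 (u 0%N)).
apply: cvgB => //; apply: cvgM; first exact: cvg_cst.
exact: cvg_harmonic.
Qed.

Lemma cvg0_div_ge (u v : nat -> R) (c : R) : 0 < c ->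
  u N @[N --> \oo] --> 0 -> (\forall N \near \oo, c <= v N) ->
  u N / v N @[N --> \oo] --> 0.
Proof.
move=> c0 hu hv; apply/norm_cvg0P.
have hu' : `|u N| / c @[N --> \oo] --> 0.
  rewrite -(mul0r c^-1); apply: cvgM; last exact: cvg_cst.
  by apply/norm_cvg0P.
apply: (squeeze_cvgr _ (cvg_cst 0) hu'); near=> N.
have cv : c <= v N by near: N.
rewrite normr_ge0/= normrM normfV ler_wpM2l// (ger0_norm (le_trans (ltW c0) cv)).
by rewrite lef_pV2 ?posrE// (lt_le_trans c0).
Unshelve. all: by end_near. Qed.

Lemma cvg0_bounded_mul (u v : nat -> R) (c : R) : (forall N, `|u N| <= c) ->
  v N / N.+1%:R @[N --> \oo] --> 0 -> u N * v N / N.+1%:R @[N --> \oo] --> 0.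
Proof.
move=> uc hv; apply/norm_cvg0P.
have hv' : c * `|v N / N.+1%:R| @[N --> \oo] --> 0.
  rewrite -(mulr0 c); apply: cvgM; first exact: cvg_cst.
  by apply/norm_cvg0P.
apply: (squeeze_cvgr _ (cvg_cst 0) hv'); near=> N.
by rewrite normr_ge0/= -mulrA normrM ler_wpM2r.
Unshelve. all: by end_near. Qed.

End AveragesToZero.

(** * Ratios of sequences of linear growth *)

Section RatioLimit.
Context {R : realType}.
Variables (f G : nat -> R) (D c : R).
Hypotheses (c0 : 0 < c) (f_lb : \forall N \near \oo, c <= f N / N.+1%:R).
Hypothesis f_nd : forall N, f N <= f N.+1.
Hypothesis GDf : (G N - D * f N) / N.+1%:R @[N --> \oo] --> 0.
Hypothesis df0 : (f N.+1 - f N) / N.+1%:R @[N --> \oo] --> 0.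

Lemma unbounded_of_linear_growth x : exists N, x < f N.
Proof.
have [M _ HM] := f_lb.
pose N := maxn M (Num.truncn (`|x| / c)).+1.
exists N; have := HM N (leq_maxl _ _); rewrite /= ler_pdivlMr//; apply: lt_le_trans.
apply: le_lt_trans (ler_norm x) _; rewrite mulrC -ltr_pdivrMr//.
apply: lt_le_trans (truncnS_gt _) _; rewrite ler_nat; apply: leqW; exact: leq_maxr.
Qed.


(** f N / N need not converge: dividing the o(N) difference G - D f by a quantity bounded below by c
    N is enough, and the hypothesis on increments absorbs the shift of index. *)
Lemma cvg_ratio_lower : G N / f N.+1 @[N --> \oo] --> D.
Proof.
have vlb : \forall N \near \oo, c <= f N.+1 / N.+1%:R.
  near=> N; apply: (@le_trans _ _ (f N / N.+1%:R)); first by near: N.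
  by rewrite ler_pM2r ?invr_gt0.
have h0 : (G N - D * f N.+1) / N.+1%:R @[N --> \oo] --> 0.
  have -> : (fun N => (G N - D * f N.+1) / N.+1%:R) =
      (fun N => (G N - D * f N) / N.+1%:R - D * ((f N.+1 - f N) / N.+1%:R)).
    by apply/funext => N; ring.
  rewrite -[X in _ --> X]subr0 -[X in _ --> _ - X](mulr0 D).
  by apply: cvgB => //; apply: cvgM => //; exact: cvg_cst.
have h1 := cvg0_div_ge c0 h0 vlb.
have : D + (G N - D * f N.+1) / N.+1%:R / (f N.+1 / N.+1%:R) @[N --> \oo] --> D.
  by rewrite -[X in _ --> X]addr0; apply: cvgD => //; exact: cvg_cst.
apply: cvg_trans; apply: near_eq_cvg; near=> N.
have v0 : 0 < f N.+1.
  by rewrite -(@pmulr_lgt0 _ N.+1%:R^-1) ?invr_gt0//; apply: lt_le_trans c0 _; near: N.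
have N0 : N.+1%:R != 0 :> R by [].
move: (N.+1%:R : R) N0 (f N.+1) v0 => x x0 v v0.
by field; rewrite x0 gt_eqF.
Unshelve. all: by end_near. Qed.

Lemma cvg_ratio_upper : G N.+1 / f N @[N --> \oo] --> D.
Proof.
have h0 : (G N.+1 - D * f N) / N.+1%:R @[N --> \oo] --> 0.
  (* The factor 1 + 1 / (N + 1) is (N + 2) / (N + 1), the correction of the denominator after
     shifting [GDf]. *)
  have -> : (fun N => (G N.+1 - D * f N) / N.+1%:R) =
      (fun N => (G N.+1 - D * f N.+1) / N.+2%:R * (1 + N.+1%:R^-1) +
                D * ((f N.+1 - f N) / N.+1%:R)).
    apply/funext => N; rewrite -[in N.+2%:R]natr1.
    have N0 : 0 < N.+1%:R :> R by [].
    move: (N.+1%:R : R) N0 => x x0.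
    by field; apply/andP; split; apply/eqP; lra.
  rewrite -[X in _ --> X]addr0 -[X in _ --> _ + X](mulr0 D) -[X in _ --> X + _](mul0r (1 + 0)).
  apply: cvgD.
    apply: cvgM; first by have := GDf; rewrite -cvg_shiftS.
    by apply: cvgD; [exact: cvg_cst|exact: cvg_harmonic].
  by apply: cvgM => //; exact: cvg_cst.
have h1 := cvg0_div_ge c0 h0 f_lb.
have : D + (G N.+1 - D * f N) / N.+1%:R / (f N / N.+1%:R) @[N --> \oo] --> D.
  by rewrite -[X in _ --> X]addr0; apply: cvgD => //; exact: cvg_cst.
apply: cvg_trans; apply: near_eq_cvg; near=> N.
have v0 : 0 < f N.
  by rewrite -(@pmulr_lgt0 _ N.+1%:R^-1) ?invr_gt0//; apply: lt_le_trans c0 _; near: N.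
have N0 : N.+1%:R != 0 :> R by [].
move: (N.+1%:R : R) N0 (f N) v0 => x x0 v v0.
by field; rewrite x0 gt_eqF.
Unshelve. all: by end_near. Qed.

End RatioLimit.

(** * The pathwise computation of the limit *)

Section SamplePathAverages.
Context {R : realType} {n : nat}.
Variables (k : nat) (len : 'I_n -> nat).
Variables (A : nat -> R) (X : nat -> 'I_n) (C : nat -> bool).
Variables (lambda q E E2 : R).
Hypotheses (lambda0 : 0 < lambda) (q0 : 0 < q) (E0 : 0 <= E).

Local Arguments Defs.free_at : simpl never.

Local Notation lag := (lag k len A X C).
Local Notation last_len := (last_len k len A X C).
Local Notation codelen := (codelen len X).
Local Notation free_at := (free_at k len A X C).
Local Notation sent := (sent k len A X C).
Local Notation age_area := (age_area k len A X C).
Local Notation y j := (lag j + A j).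
Local Notation s j := ((selected k X C j)%:R : R).
Local Notation mu := (lambda^-1).
Local Notation m := (mu / q).

Definition when_idle (h : R -> R) (j : nat) : R :=
  if 0 <= lag j + A j then h (lag j + A j) else 0.
Definition idle_time (j : nat) : R := Num.max (lag j) 0.
(** The conditional probability, given the past, that packet j finds the transmitter idle: an
    exponential interarrival time has to outlast the residual service. *)
Definition idle_prob (j : nat) : R := expR (- lambda * Num.max (- lag j) 0).

Local Notation b := (when_idle).
Local Notation w := (idle_time).
Local Notation e := (idle_prob).

(** A crude bound on all codeword lengths; a sum rather than a maximum, so that splitting off one
    term proves it. *)
Definition max_len : R := \sum_(i < n) (len i)%:R.

Lemma codelen_le j : codelen j <= max_len.
Proof.
rewrite /max_len (bigD1 (X j))//= lerDl; exact: sumr_ge0.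
Qed.

Lemma last_len_le j : last_len j <= max_len.
Proof.
elim: j => [|j IH] /=; first exact: sumr_ge0.
by case: ifPn => // _; exact: codelen_le.
Qed.

(** A positive elapsed idle time means no residual service, so the next packet finds the transmitter
    idle with probability 1. *)
Lemma idle_time_mul_prob j : w j * e j = w j.
Proof.
rewrite /w /e; case: leP => [|z0]; first by rewrite mul0r.
by rewrite max_r ?oppr_le0 ?ltW// mulr0 expR0 mulr1.
Qed.

(** Idle time is carried past an arrival exactly when the packet is discarded by the selection; this
    recursion makes the sums below telescope. *)
Lemma idle_timeS j : w j.+1 = b id j * (1 - s j).
Proof.
rewrite /w /b /=; case: (leP 0 (y j)) => y0 /=; last by rewrite mul0r max_r// ltW.
case: (selected k X C j) => /=.
  by rewrite subrr mulr0 max_r// oppr_le0 codelen_ge0.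
by rewrite subr0 mulr1 max_l.
Qed.

Lemma last_lenS j : last_len j.+1 = last_len j + (sent j)%:R * (codelen j - last_len j).
Proof.
by rewrite sent_lag /=; case: ifPn => _ /=; rewrite ?mul1r ?mul0r ?addr0// addrC subrK.
Qed.

Lemma idle_prob_ge (A0 : forall j, 0 <= A j) j : expR (- lambda * max_len) <= e j.
Proof.
have lagL i : - max_len <= lag i.
  elim: i => [|i IH] /=; first by rewrite oppr_le0; exact: sumr_ge0.
  by case: ifPn => _; [rewrite lerN2 codelen_le|rewrite (le_trans IH)// lerDl].
rewrite /e ler_expR ler_nM2l ?oppr_lt0// ge_max lerNl lagL/=; exact: sumr_ge0.
Qed.

Hypothesis A0 : forall j, 0 <= A j.
Hypothesis w0 : w N / N.+1%:R @[N --> \oo] --> 0.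
Hypothesis w20 : w N ^+ 2 / N.+1%:R @[N --> \oo] --> 0.
Hypothesis y0 : b id N / N.+1%:R @[N --> \oo] --> 0.
Hypothesis II0 : avg0 (fun j => b (cst 1) j - e j).
Hypothesis II1 : avg0 (fun j => b id j - (w j + mu) * e j).
Hypothesis II2 : avg0 (fun j => b (fun y => y ^+ 2) j
   - (w j ^+ 2 + 2 * mu * w j + 2 * mu ^+ 2) * e j).
Hypothesis IIl0 : avg0 (fun j => last_len j * (b (cst 1) j - e j)).
Hypothesis IIl1 : avg0 (fun j => last_len j * (b id j - (w j + mu) * e j)).
Hypothesis Is0 : avg0 (fun j => b (cst 1) j * (s j - q)).
Hypothesis Is1 : avg0 (fun j => b id j * (s j - q)).
Hypothesis Isl : avg0 (fun j => last_len j * b (cst 1) j * (s j - q)).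
Hypothesis IL0 : avg0 (fun j => b (cst 1) j * (s j * (codelen j - E))).
Hypothesis IL1 : avg0 (fun j => b id j * (s j * (codelen j - E))).
Hypothesis ILl : avg0 (fun j => last_len j * b (cst 1) j * (s j * (codelen j - E))).
Hypothesis IL2 : avg0 (fun j => b (cst 1) j * (s j * (codelen j ^+ 2 - E2))).

Local Notation sj j := ((sent j)%:R : R).

Let m0 : 0 < m. Proof. by rewrite divr_gt0// invr_gt0. Qed.

Let dw : avg0 (fun j => w j - w j.+1). Proof. exact: avg0_telescope. Qed.

Let dw2 : avg0 (fun j => w j ^+ 2 - w j.+1 ^+ 2).
Proof. exact: (avg0_telescope (u := fun j => w j ^+ 2)). Qed.

Let last_len_norm N : `|last_len N| <= max_len.
Proof. by rewrite ger0_norm ?last_len_ge0// last_len_le. Qed.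

Let dlw : avg0 (fun j => last_len j * w j - last_len j.+1 * w j.+1).
Proof.
apply: (avg0_telescope (u := fun j => last_len j * w j)).
exact: cvg0_bounded_mul last_len_norm w0.
Qed.

(** On average the codeword preceding a transmission is as long as the one being sent; this will
    produce the summand [E] of [D]. *)
Let dl : avg0 (fun j => last_len j - last_len j.+1).
Proof.
apply: avg0_telescope.
have h : 1 / N.+1%:R @[N --> \oo] --> (0 : R).
  by under eq_fun do rewrite mul1r; exact: cvg_harmonic.
have := cvg0_bounded_mul (v := fun=> 1) last_len_norm h.
by under eq_fun do rewrite mulr1.
Qed.

Ltac cases j := rewrite ?idle_timeS ?last_lenS sent_lag /when_idle;
  case: (leP 0 (y j)) => _ /=; case: (selected k X C j) => /=.

(** The mean idle time per transmission is [m]. The idle time left by discarded packets telescopes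
    in [dw], so no geometric sum appears; [mu] per idle arrival becomes [mu / q] per transmission
    because a fraction q of the idle arrivals is selected. *)
Let t1 : avg0 (fun j => sj j * y j - m * sj j).
Proof.
apply: eq_avg0 (avg0D (avg0D II1 dw) (avg0D (avg0Z (- m) Is0) (avg0Z (- mu) II0))) => j.
have := idle_time_mul_prob j; move: (w j) (e j) => wj ej we.
rewrite mulrDl we.
by cases j; field; rewrite !gt_eqF.
Qed.

Let t2 : avg0 (fun j => sj j - q * e j).
Proof.
apply: eq_avg0 (avg0D Is0 (avg0Z q II0)) => j.
by cases j; ring.
Qed.

Let t3 : avg0 (fun j => sj j * codelen j - E * sj j).
Proof. by apply: eq_avg0 IL0 => j; cases j; ring. Qed.

(** 2 m^2 is the second moment of an exponential variable of mean m. The block weighted by [2 * m]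
    amounts to q w - (1 - q) mu e and cancels the term 2 mu w left by [II2] and [dw2]. *)
Let t4 : avg0 (fun j => sj j * y j ^+ 2 - 2 * m ^+ 2 * sj j).
Proof.
apply: eq_avg0 (avg0D (avg0D II2 dw2)
  (avg0D (avg0Z (2 * m) (avg0D dw (avg0D (avg0Z (1 - q) II1) (avg0Z (-1) Is1))))
         (avg0Z (- (2 * m ^+ 2)) (avg0D Is0 (avg0Z q II0))))) => j.
have := idle_time_mul_prob j; move: (w j) (e j) => wj ej we.
have -> : (wj + mu) * ej = wj + mu * ej by rewrite mulrDl we.
have -> : (wj ^+ 2 + 2 * mu * wj + 2 * mu ^+ 2) * ej =
    wj * (wj * ej) + 2 * mu * (wj * ej) + 2 * mu ^+ 2 * ej by ring.
rewrite we.
by cases j; field; rewrite !gt_eqF.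
Qed.

Let t5 : avg0 (fun j => sj j * (y j * codelen j) - E * (sj j * y j)).
Proof. by apply: eq_avg0 IL1 => j; cases j; ring. Qed.

Let t6 : avg0 (fun j => sj j * codelen j ^+ 2 - E2 * sj j).
Proof. by apply: eq_avg0 IL2 => j; cases j; ring. Qed.

(** The argument of [t1] with weight [last_len]: a discarded packet leaves the weight unchanged and
    a sent one resets the idle time to 0, so the weighted product still telescopes. *)
Let t7 : avg0 (fun j => sj j * (last_len j * y j) - m * (sj j * last_len j)).
Proof.
apply: eq_avg0 (avg0D (avg0D IIl1 dlw) (avg0D (avg0Z (- m) Isl) (avg0Z (- mu) IIl0))) => j.
have := idle_time_mul_prob j; move: (w j) (e j) => wj ej we.
rewrite mulrDl we.
by cases j; field; rewrite !gt_eqF.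
Qed.

Let t8 : avg0 (fun j => sj j * (last_len j * codelen j) - E * (sj j * last_len j)).
Proof. by apply: eq_avg0 ILl => j; cases j; ring. Qed.

Let D := (E2 + 2 * m * E + 2 * m ^+ 2) / (2 * (E + m)) + E.

Let step_f j := sj j * (y j + codelen j).
Let step_G j := sj j * (last_len j * (y j + codelen j) + (y j + codelen j) ^+ 2 / 2).

(** [dl] trades the previous codeword length for the current one; [t3] and [t1] then turn what
    remains into a multiple of [sent], and [D] is the value for which that coefficient vanishes. *)
Let area_minus_time : avg0 (fun j => step_G j - D * step_f j).
Proof.
have Em : 0 < E + m by rewrite ltr_wpDl.
apply: eq_avg0 (avg0D (avg0D (avg0D t7 t8) (avg0D (avg0Z (1 / 2) t4) t5))
  (avg0D (avg0D (avg0Z (1 / 2) t6) (avg0Z (E + m) dl))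
         (avg0D (avg0Z (E + m - D) t3) (avg0Z (E - D) t1)))) => j.
rewrite last_lenS /step_G /step_f /D.
move: m m0 Em => x x0 Em.
by case: (sent j) => /=; field; rewrite ?gt_eqF//; lra.
Qed.

Let free_atE N : free_at N = \sum_(0 <= j < N) step_f j.
Proof.
elim: N => [|N IH]; first by rewrite big_geq.
rewrite big_nat_recr// -IH free_atS /step_f.
by case: ifPn => _; rewrite ?mul1r ?mul0r.
Qed.

Lemma avg_age_cvg_of_averages :
  avg_age k len A X C t @[t --> +oo] --> D%:E.
Proof.
have c0 : 0 < (E + m) * q * expR (- lambda * max_len).
  by rewrite !mulr_gt0 ?expR_gt0// ltr_wpDl.
(* With 4 c as the lower bound per arrival, an error below c (N + 1) still leaves 4 c N - c (N + 1)
   >= c (N + 1) for N >= 1. *)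
pose c := (E + m) * q * expR (- lambda * max_len) / 4.
have cpos : 0 < c by rewrite divr_gt0.
have f_lb : \forall N \near \oo, c <= free_at N / N.+1%:R.
  have h : avg0 (fun j => step_f j - (E + m) * q * e j).
    apply: eq_avg0 (avg0D (avg0D t1 t3) (avg0Z (E + m) t2)) => j.
    by rewrite /step_f; ring.
  have /cvgrPdist_lt/(_ _ cpos) h' := h.
  near=> N.
  have : `|0 - (\sum_(0 <= j < N) (step_f j - (E + m) * q * e j)) / N.+1%:R| < c.
    by near: N.
  rewrite sub0r normrN ltr_norml => /andP[hN _].
  have N1 : (1 <= N)%N by near: N; exact: nbhs_infty_ge.
  have le4 : 4 * c * N%:R <= \sum_(0 <= j < N) (E + m) * q * e j.
    have -> : 4 * c * N%:R = \sum_(0 <= j < N) 4 * c.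
      by rewrite sumr_const_nat subn0 -[RHS]mulr_natr.
    apply: ler_sum => j _.
    rewrite /c mulrC divfK// ler_wpM2l// ?idle_prob_ge//.
    by rewrite ltW// mulr_gt0// ltr_wpDl.
  rewrite free_atE ler_pdivlMr//.
  have : - c * N.+1%:R < \sum_(0 <= j < N) (step_f j - (E + m) * q * e j).
    by rewrite -ltr_pdivlMr.
  rewrite sumrB -natr1.
  have N1' : 1 <= N%:R :> R by rewrite ler1n.
  have cN : c <= c * N%:R by rewrite ler_peMr// ltW.
  move: cN le4; rewrite mulrDr mulr1 mulNr [4 * c * _]mulrAC => cN le4; lra.
have Gdf : (age_area N - D * free_at N) / N.+1%:R @[N --> \oo] --> 0.
  have := area_minus_time; rewrite /avg0.
  by under eq_fun do rewrite sumrB -mulr_sumr -free_atE.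
have df : (free_at N.+1 - free_at N) / N.+1%:R @[N --> \oo] --> 0.
  have h : (b id N + max_len) / N.+1%:R @[N --> \oo] --> 0.
    have -> : (fun N => (b id N + max_len) / N.+1%:R) =
        (fun N => b id N / N.+1%:R + max_len / N.+1%:R).
      by apply/funext => N; rewrite mulrDl.
    rewrite -[X in _ --> X]addr0; apply: cvgD => //.
    rewrite -[X in _ --> X](mulr0 max_len); apply: cvgM; first exact: cvg_cst.
    exact: cvg_harmonic.
  apply: (squeeze_cvgr _ (cvg_cst 0) h); near=> N.
  have nd := free_at_nd k len A X C (leqnSn N).
  rewrite divr_ge0 ?subr_ge0//= ler_pM2r ?invr_gt0// free_atS addrC addKr sent_lag /b.
  have cl := codelen_le N; have c1 := codelen_ge0 (R := R) len X N.
  case: (leP 0 (y N)) => y1 /=; last by rewrite add0r (le_trans c1).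
  by case: ifPn => _; [rewrite lerD2l|rewrite addr_ge0// (le_trans c1)].
have nd N : free_at N <= free_at N.+1 by exact: free_at_nd.
apply: avg_age_cvg.
- exact: unbounded_of_linear_growth cpos f_lb.
- exact: (cvg_ratio_lower cpos f_lb nd Gdf df).
- exact: (cvg_ratio_upper cpos f_lb Gdf df).
Unshelve. all: by end_near. Qed.

End SamplePathAverages.

(** * Sigma-algebras generated by finitely many coordinates *)

Section Cylinders.
Context {d : measure_display} {T : measurableType d} {R : realType}.
Variables (P : probability T R) (n : nat).
Variables (A : nat -> T -> R) (X : nat -> T -> 'I_n) (C : nat -> T -> bool).
Implicit Types (B : nat -> set R) (S : nat -> set 'I_n) (D : nat -> set bool).

Definition rectangle (JA JX JC : seq nat) B S D : set T :=
  \big[setI/setT]_(j <- JA) (A j @^-1` B j)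
  `&` \big[setI/setT]_(j <- JX) (X j @^-1` S j)
  `&` \big[setI/setT]_(j <- JC) (C j @^-1` D j).

Definition cylinders (JA JX JC : seq nat) : set (set T) :=
  [set E | exists B S D, (forall j, measurable (B j)) /\ E = rectangle JA JX JC B S D].

Lemma rectangleP JA JX JC B S D w : rectangle JA JX JC B S D w <->
  [/\ forall j, j \in JA -> B j (A j w), forall j, j \in JX -> S j (X j w)
    & forall j, j \in JC -> D j (C j w)].
Proof.
rewrite /rectangle -!bigcap_seq; split.
  by move=> [[h1 h2] h3]; split=> j jJ; [apply: h1|apply: h2|apply: h3].
by move=> [h1 h2 h3]; split; [split|] => j jJ; [apply: h1|apply: h2|apply: h3].
Qed.

Lemma cylinders_setI_closed JA JX JC : setI_closed (cylinders JA JX JC).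
Proof.
move=> _ _ [B [S [D [mB ->]]]] [B' [S' [D' [mB' ->]]]].
exists (fun j => B j `&` B' j), (fun j => S j `&` S' j), (fun j => D j `&` D' j).
split; first by move=> j; exact: measurableI.
apply/seteqP; split => w; rewrite /setI/= !rectangleP.
  move=> [[a b c] [a' b' c']].
  by split=> j jJ; split; [exact: a|exact: a'|exact: b|exact: b'|exact: c|exact: c'].
by move=> [a b c]; split; split=> j jJ; [case: (a _ jJ)|case: (b _ jJ)|case: (c _ jJ)
  |case: (a _ jJ)|case: (b _ jJ)|case: (c _ jJ)].
Qed.

Lemma cylinders_setT JA JX JC : cylinders JA JX JC setT.
Proof.
exists (fun=> setT), (fun=> setT), (fun=> setT); split => //.
by apply/seteqP; split => w // _; apply/rectangleP.
Qed.

Lemma cylinders_A JA JX JC j (B : set R) : j \in JA -> measurable B ->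
  cylinders JA JX JC (A j @^-1` B).
Proof.
move=> jJ mB; exists (fun i => if i == j then B else setT), (fun=> setT), (fun=> setT).
split; first by move=> i; case: ifP.
apply/seteqP; split => w.
  by move=> Bw; apply/rectangleP; split => // i _; case: eqP => // ->.
by move=> /rectangleP[/(_ j jJ)]; rewrite eqxx.
Qed.

Lemma cylinders_X JA JX JC j (S : set 'I_n) : j \in JX ->
  cylinders JA JX JC (X j @^-1` S).
Proof.
move=> jJ; exists (fun=> setT), (fun i => if i == j then S else setT), (fun=> setT).
split => //; apply/seteqP; split => w.
  by move=> Bw; apply/rectangleP; split => // i _; case: eqP => // ->.
by move=> /rectangleP[_ /(_ j jJ)]; rewrite eqxx.
Qed.

Lemma cylinders_C JA JX JC j (D : set bool) : j \in JC ->
  cylinders JA JX JC (C j @^-1` D).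
Proof.
move=> jJ; exists (fun=> setT), (fun=> setT), (fun i => if i == j then D else setT).
split => //; apply/seteqP; split => w.
  by move=> Bw; apply/rectangleP; split => // i _; case: eqP => // ->.
by move=> /rectangleP[_ _ /(_ j jJ)]; rewrite eqxx.
Qed.

Lemma measurable_cyl_A JA JX JC j : j \in JA ->
  measurable_fun [set: g_sigma_algebraType (cylinders JA JX JC)] (A j).
Proof.
by move=> jJ _ B mB; rewrite setTI; apply: sub_sigma_algebra; exact: cylinders_A.
Qed.

(** Quantifying over all functions of realization and coin spares fixing a sigma-algebra on the
    finite alphabet; the proof splits on the coin. *)
Lemma measurable_cyl_XC JA JX JC j (dU : measure_display) (U : measurableType dU)
    (f : 'I_n -> bool -> U) : j \in JX -> j \in JC ->
  measurable_fun [set: g_sigma_algebraType (cylinders JA JX JC)]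
    (fun w => f (X j w) (C j w)).
Proof.
move=> jX jC _ Y mY; rewrite setTI.
rewrite (_ : _ @^-1` Y =
  (X j @^-1` [set i | Y (f i true)] `&` C j @^-1` [set true]) `|`
  (X j @^-1` [set i | Y (f i false)] `&` C j @^-1` [set false])).
  by apply: (@measurableU _ (g_sigma_algebraType (cylinders JA JX JC)));
    apply: (@measurableI _ (g_sigma_algebraType (cylinders JA JX JC)));
    apply: sub_sigma_algebra; [exact: cylinders_X|exact: cylinders_C
      |exact: cylinders_X|exact: cylinders_C].
apply/seteqP; split => w /=; first by case: (C j w) => ?; [left|right].
by move=> [[+ ->]|[+ ->]].
Qed.

Hypothesis mA : forall j, measurable_fun setT (A j).
Hypothesis mX : forall j i, measurable [set w | X j w = i].
Hypothesis mC : forall j, measurable [set w | C j w].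

Lemma cylinders_measurable JA JX JC : cylinders JA JX JC `<=` measurable.
Proof.
move=> _ [B [S [D [mB ->]]]]; rewrite /rectangle -!bigcap_seq.
apply: measurableI; first apply: measurableI.
- by apply: fin_bigcap_measurable => // j _; rewrite -[X in measurable X]setTI; exact: mA.
- apply: fin_bigcap_measurable => // j _.
  rewrite (_ : _ @^-1` _ = \bigcup_(i in S j) [set w | X j w = i]).
    by apply: fin_bigcup_measurable => // i _; exact: mX.
  by apply/seteqP; split => [w Sw|w [i Si /= ->]] //; exists (X j w).
- apply: fin_bigcap_measurable => // j _.
  rewrite (_ : _ @^-1` _ = [set w | C j w /\ D j true] `|` [set w | ~ C j w /\ D j false]).
    apply: measurableU.
      have [DT|DF] := pselect (D j true).
        by rewrite (_ : [set _ | _] = [set w | C j w])//; apply/seteqP; split => w //= [].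
      by rewrite (_ : [set _ | _] = set0)//; apply/seteqP; split => w //= [].
    have [DT|DF] := pselect (D j false).
      rewrite (_ : [set _ | _] = ~` [set w | C j w]); first exact: measurableC.
      by apply/seteqP; split => w //= [].
    by rewrite (_ : [set _ | _] = set0)//; apply/seteqP; split => w //= [].
  apply/seteqP; split => w /=; first by case: (C j w) => ?; [left|right].
  by move=> [[Cw]|[/negP/negbTE Cw]]; rewrite Cw.
Qed.

Hypothesis indep : mutually_independent P A X C.

Lemma independent_cylinders JA JX JC JA' JX' JC' :
  uniq (JA ++ JA') -> uniq (JX ++ JX') -> uniq (JC ++ JC') ->
  independent_systems P (cylinders JA JX JC) (cylinders JA' JX' JC').
Proof.
move=> uA uX uC _ _ [B [S [D [mB ->]]]] [B' [S' [D' [mB' ->]]]].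
have PR J1 J2 J3 B1 S1 D1 : uniq J1 -> uniq J2 -> uniq J3 -> (forall j, measurable (B1 j)) ->
    P (rectangle J1 J2 J3 B1 S1 D1) = (\prod_(j <- J1) P (A j @^-1` B1 j) *
     \prod_(j <- J2) P (X j @^-1` S1 j) * \prod_(j <- J3) P (C j @^-1` D1 j))%E.
  by move=> *; exact: indep.
have [uA1 /hasPn nA uA2] := (and3P (etrans (esym (cat_uniq _ _)) uA)).
have [uX1 /hasPn nX uX2] := (and3P (etrans (esym (cat_uniq _ _)) uX)).
have [uC1 /hasPn nC uC2] := (and3P (etrans (esym (cat_uniq _ _)) uC)).
(* As the index lists are disjoint, the two rectangles intersect in one rectangle over the
   concatenated lists, whose probability is a product by hypothesis. *)
pose glue (Y : Type) (J : seq nat) (f g : nat -> Y) j := if j \in J then f j else g j.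
have -> : rectangle JA JX JC B S D `&` rectangle JA' JX' JC' B' S' D' =
    rectangle (JA ++ JA') (JX ++ JX') (JC ++ JC')
      (glue _ JA B B') (glue _ JX S S') (glue _ JC D D').
  apply/seteqP; split => w; rewrite /setI/= !rectangleP /glue.
    move=> [[a b c] [a' b' c']]; split=> j; rewrite mem_cat; case: ifPn => //= jJ.
    - by move=> _; exact: a.
    - exact: a'.
    - by move=> _; exact: b.
    - exact: b'.
    - by move=> _; exact: c.
    - exact: c'.
  move=> [a b c]; split; split => j jJ.
  - by have := a j; rewrite mem_cat jJ; apply.
  - by have := b j; rewrite mem_cat jJ; apply.
  - by have := c j; rewrite mem_cat jJ; apply.
  - by have := a j; rewrite mem_cat jJ orbT (negbTE (nA _ jJ)); apply.
  - by have := b j; rewrite mem_cat jJ orbT (negbTE (nX _ jJ)); apply.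
  - by have := c j; rewrite mem_cat jJ orbT (negbTE (nC _ jJ)); apply.
have glueE (Y : Type) (J J' : seq nat) (f g : nat -> Y) (Q : nat -> Y -> \bar R) :
    (forall j, j \in J' -> j \notin J) ->
    (\prod_(j <- J ++ J') Q j (glue _ J f g j) =
     \prod_(j <- J) Q j (f j) * \prod_(j <- J') Q j (g j))%E.
  move=> nJ; rewrite big_cat/=; congr (_ * _)%E.
    by apply: eq_big_seq => j jJ; rewrite /glue jJ.
  by apply: eq_big_seq => j /nJ jJ; rewrite /glue (negbTE jJ).
rewrite !PR//; last by move=> j; rewrite /glue; case: ifP.
rewrite (glueE _ _ _ _ _ (fun j b => P (A j @^-1` b)))//.
rewrite (glueE _ _ _ _ _ (fun j b => P (X j @^-1` b)))//.
rewrite (glueE _ _ _ _ _ (fun j b => P (C j @^-1` b)))//.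
by rewrite [RHS]muleACA; congr (_ * _)%E; exact: muleACA.
Qed.

End Cylinders.

(** Stated over an arbitrary measurable space so that it applies to each of the history
    sigma-algebras carried by the sample space. *)
Lemma measurable_lag_last_len {R : realType} {n : nat} (k : nat) (len : 'I_n -> nat)
    (d' : measure_display) (T' : measurableType d')
    (A : nat -> T' -> R) (X : nat -> T' -> 'I_n) (C : nat -> T' -> bool) (j : nat) :
  (forall i, (i < j)%N -> measurable_fun setT (A i)) ->
  (forall i, (i < j)%N -> forall (dU : measure_display) (U : measurableType dU)
     (f : 'I_n -> bool -> U), measurable_fun setT (fun w => f (X i w) (C i w))) ->
  measurable_fun setT (fun w => lag k len (A^~ w) (X^~ w) (C^~ w) j) /\
  measurable_fun setT (fun w => last_len k len (A^~ w) (X^~ w) (C^~ w) j).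
Proof.
elim: j => [|j IH] mA mXC; first by split; exact: measurable_cst.
have [m1 m2] := IH (fun i ij => mA i (leqW ij)) (fun i ij => mXC i (leqW ij)).
have my : measurable_fun setT (fun w => lag k len (A^~ w) (X^~ w) (C^~ w) j + A j w).
  by apply: measurable_funD => //; exact: mA.
have mb : measurable_fun setT (fun w =>
    (0 <= lag k len (A^~ w) (X^~ w) (C^~ w) j + A j w) &&
    selected k (X^~ w) (C^~ w) j).
  apply: measurable_and; first exact: measurable_fun_ler.
  exact: (mXC j (ltnSn j) _ _ (fun x c => (x < k)%N || c)).
have mL := mXC j (ltnSn j) _ _ (fun x _ => (len x)%:R : R).
split => /=; apply: measurable_fun_ifT => //; exact: measurableT_comp mL.
Qed.

(** * Integration conditionally on the history *)

Section Freezing.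
Context {d : measure_display} {T : measurableType d} {R : realType}.
Variables (P : probability T R) (n : nat).
Variables (A : nat -> T -> R) (X : nat -> T -> 'I_n) (C : nat -> T -> bool).
Hypothesis mA : forall j, measurable_fun setT (A j).
Hypothesis mX : forall j i, measurable [set w | X j w = i].
Hypothesis mC : forall j, measurable [set w | C j w].
Hypothesis indep : mutually_independent P A X C.

(** Two histories are needed: the interarrival time j is averaged given [past j], and then
    realization and coin j given [past_arrival j], which already decides whether the packet finds
    the transmitter idle. *)
Definition past j := cylinders A X C (iota 0 j) (iota 0 j) (iota 0 j).
Definition past_arrival j := cylinders A X C (iota 0 j.+1) (iota 0 j) (iota 0 j).

Local Notation TP j := (g_sigma_algebraType (past j)).
Local Notation TA j := (g_sigma_algebraType (past_arrival j)).
Local Notation arr j := (cylinders A X C [:: j] [::] [::]).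
Local Notation mark j := (cylinders A X C [::] [:: j] [:: j]).

Let iota_rcons_uniq j : uniq (iota 0 j ++ [:: j]).
Proof. by rewrite cats1 rcons_uniq iota_uniq mem_iota/= add0n ltnn. Qed.

Let indA j : independent_systems P (past j) (arr j).
Proof. by apply: independent_cylinders => //; rewrite cats0 iota_uniq. Qed.

Let indM j : independent_systems P (past_arrival j) (mark j).
Proof. by apply: independent_cylinders => //; rewrite cats0 iota_uniq. Qed.

Let mcyl JA JX JC : cylinders A X C JA JX JC `<=` measurable.
Proof. exact: cylinders_measurable. Qed.

Let measurable_cyl_T JA JX JC (f : T -> R) :
  measurable_fun [set: g_sigma_algebraType (cylinders A X C JA JX JC)] f ->
  measurable_fun [set: T] f.
Proof.
move=> mf _ B mB; have := mf (@measurableT _ _) B mB.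
exact: (sub_gen_sigma_measurable (mcyl (JA := JA) (JX := JX) (JC := JC))).
Qed.

Lemma measurable_past_T j (f : T -> R) :
  measurable_fun [set: TP j] f -> measurable_fun [set: T] f.
Proof. exact: measurable_cyl_T. Qed.

Lemma measurable_past_arrival_T j (f : T -> R) :
  measurable_fun [set: TA j] f -> measurable_fun [set: T] f.
Proof. exact: measurable_cyl_T. Qed.

Section Arrival.
Variables (j : nat) (g : R -> R -> R) (u : T -> R).
Hypotheses (mg : measurable_fun [set: R * R] (fun x => g x.1 x.2)).
Hypothesis mu_ : measurable_fun [set: TP j] u.

Let mgu : measurable_fun [set: TP j * g_sigma_algebraType (arr j)]
  (fun x => g (u x.1) (A j x.2)).
Proof.
have m1 : measurable_fun [set: TP j * g_sigma_algebraType (arr j)] (fun x => u x.1).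
  exact: measurableT_comp mu_ measurable_fst.
have mAj : measurable_fun [set: g_sigma_algebraType (arr j)] (A j).
  by apply: measurable_cyl_A; exact: mem_head.
have m2 : measurable_fun [set: TP j * g_sigma_algebraType (arr j)] (fun x => A j x.2).
  exact: measurableT_comp mAj measurable_snd.
exact: measurableT_comp mg (measurable_fun_pair m1 m2).
Qed.

(** The nonnegative version serves the moment bounds, where integrability is not yet available; the
    signed version below gives orthogonality. *)
Lemma ge0_integral_freeze_arrival : (forall z a, 0 <= g z a) ->
  (\int[P]_w (g (u w) (A j w))%:E = \int[P]_w \int[P]_w' (g (u w) (A j w'))%:E)%E.
Proof.
move=> g0.
apply: (ge0_integral_freeze (@mcyl _ _ _) (@mcyl _ _ _) (@cylinders_setI_closed _ _ _ _ _ _ _ _ _ _)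
  (@cylinders_setI_closed _ _ _ _ _ _ _ _ _ _) (@cylinders_setT _ _ _ _ _ _ _ _ _ _)
  (@cylinders_setT _ _ _ _ _ _ _ _ _ _) (indA (j := j))
  (f := fun x => (g (u x.1) (A j x.2))%:E)).
  exact/measurable_EFinP.
by move=> x; rewrite lee_fin.
Qed.

Lemma integral_freeze_arrival (v : T -> R) :
  measurable_fun [set: TP j] v ->
  (forall z, P.-integrable setT (fun w => (g z (A j w))%:E)) ->
  (forall z, \int[P]_w (g z (A j w))%:E = 0)%E ->
  P.-integrable setT (fun w => (v w * g (u w) (A j w))%:E) ->
  (\int[P]_w (v w * g (u w) (A j w))%:E = 0)%E.
Proof.
move=> mv ig g0 iv.
rewrite (integral_freeze (@mcyl _ _ _) (@mcyl _ _ _) (@cylinders_setI_closed _ _ _ _ _ _ _ _ _ _)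
  (@cylinders_setI_closed _ _ _ _ _ _ _ _ _ _) (@cylinders_setT _ _ _ _ _ _ _ _ _ _)
  (@cylinders_setT _ _ _ _ _ _ _ _ _ _) (indA (j := j))
  (f := fun x => (v x.1 * g (u x.1) (A j x.2))%:E))//.
  apply: integral0_eq => w _ /=.
  under eq_integral do rewrite EFinM.
  by rewrite integralZl// g0 mule0.
apply/measurable_EFinP; apply: measurable_funM => //.
exact: measurableT_comp mv measurable_fst.
Qed.

End Arrival.

Section Mark.
Variables (j : nat) (rho : 'I_n -> bool -> R) (v : T -> R).
Hypothesis mv : measurable_fun [set: TA j] v.

Let mvrho : measurable_fun [set: TA j * g_sigma_algebraType (mark j)]
  (fun x => v x.1 * rho (X j x.2) (C j x.2)).
Proof.
apply: measurable_funM; first exact: measurableT_comp mv measurable_fst.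
have mr : measurable_fun [set: g_sigma_algebraType (mark j)] (fun w => rho (X j w) (C j w)).
  by apply: measurable_cyl_XC; exact: mem_head.
exact: measurableT_comp mr measurable_snd.
Qed.

Lemma measurable_mark : measurable_fun [set: T] (fun w => rho (X j w) (C j w)).
Proof.
have mr : measurable_fun [set: g_sigma_algebraType (mark j)] (fun w => rho (X j w) (C j w)).
  by apply: measurable_cyl_XC; exact: mem_head.
exact: measurable_cyl_T mr.
Qed.

Lemma ge0_integral_freeze_mark : (forall w, 0 <= v w) -> (forall x c, 0 <= rho x c) ->
  (\int[P]_w (v w * rho (X j w) (C j w))%:E =
   \int[P]_w (v w)%:E * \int[P]_w (rho (X j w) (C j w))%:E)%E.
Proof.
move=> v0 rho0.
rewrite (ge0_integral_freeze (@mcyl _ _ _) (@mcyl _ _ _) (@cylinders_setI_closed _ _ _ _ _ _ _ _ _ _)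
  (@cylinders_setI_closed _ _ _ _ _ _ _ _ _ _) (@cylinders_setT _ _ _ _ _ _ _ _ _ _)
  (@cylinders_setT _ _ _ _ _ _ _ _ _ _) (indM (j := j))
  (f := fun x => (v x.1 * rho (X j x.2) (C j x.2))%:E)); last 2 first.
- exact/measurable_EFinP.
- by move=> x; rewrite lee_fin mulr_ge0.
have mr := measurable_mark.
transitivity (\int[P]_w ((v w)%:E * \int[P]_w' (rho (X j w') (C j w'))%:E))%E.
  apply: eq_integral => w _ /=; rewrite -ge0_integralZl_EFin//.
  - by move=> w' _; rewrite lee_fin.
  - exact/measurable_EFinP.
rewrite ge0_integralZr//.
- by apply/measurable_EFinP; exact: measurable_past_arrival_T mv.
- by move=> w _; rewrite lee_fin.
- by apply: integral_ge0 => w _; rewrite lee_fin.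
Qed.

Lemma integral_freeze_mark :
  P.-integrable setT (fun w => (rho (X j w) (C j w))%:E) ->
  (\int[P]_w (rho (X j w) (C j w))%:E = 0)%E ->
  P.-integrable setT (fun w => (v w * rho (X j w) (C j w))%:E) ->
  (\int[P]_w (v w * rho (X j w) (C j w))%:E = 0)%E.
Proof.
move=> ir r0 iv.
rewrite (integral_freeze (@mcyl _ _ _) (@mcyl _ _ _) (@cylinders_setI_closed _ _ _ _ _ _ _ _ _ _)
  (@cylinders_setI_closed _ _ _ _ _ _ _ _ _ _) (@cylinders_setT _ _ _ _ _ _ _ _ _ _)
  (@cylinders_setT _ _ _ _ _ _ _ _ _ _) (indM (j := j))
  (f := fun x => (v x.1 * rho (X j x.2) (C j x.2))%:E))//.
  apply: integral0_eq => w _ /=.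
  under eq_integral do rewrite EFinM.
  by rewrite integralZl// r0 mule0.
exact/measurable_EFinP.
Qed.

End Mark.
End Freezing.

(** * Moment bounds and almost sure averages for the random system *)

Section UpdateSystem.
Context {R : realType} {d : measure_display} {T : measurableType d}.
Variables (P : probability T R) (n k : nat) (p : 'I_n -> R) (len : 'I_n -> nat).
Variables (alpha lambda : R).
Variables (A : nat -> T -> R) (X : nat -> T -> 'I_n) (C : nat -> T -> bool).
Hypotheses (k0 : (0 < k)%N) (kn : (k <= n)%N) (lambda0 : 0 < lambda).
Hypothesis alpha01 : 0 <= alpha <= 1.
Hypotheses (p0 : forall i, 0 <= p i) (p1 : \sum_(i < n) p i = 1).
Hypothesis p_nincr : forall i j : 'I_n, (i <= j)%N -> p j <= p i.
Hypothesis mA : forall j, measurable_fun setT (A j).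
Hypothesis mX : forall j i, measurable [set w | X j w = i].
Hypothesis mC : forall j, measurable [set w | C j w].
Hypothesis A_cdf : forall j s, 0 <= s ->
  P [set w | A j w <= s] = (1 - expR (- lambda * s))%:E.
Hypothesis X_pmf : forall j i, P [set w | X j w = i] = (p i)%:E.
Hypothesis C_prob : forall j, P [set w | C j w] = alpha%:E.
Hypothesis indep : mutually_independent P A X C.

Local Notation q := (q_ka k p alpha).

(** The probability that a packet carries x_i and is selected, i.e. q times the conditional pmf
    [p_alpha]. *)
Let send_weight (i : 'I_n) : R := if (i < k)%N then p i else alpha * p i.

Let sum_send_weight : \sum_(i < n) send_weight i = q.
Proof.
rewrite /q_ka (bigID (fun i : 'I_n => (i < k)%N))/=; congr (_ + _).
  by apply: eq_bigr => i ik; rewrite /send_weight ik.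
rewrite mulr_sumr; under [RHS]eq_bigl do rewrite leqNgt.
by apply: eq_bigr => i ik; rewrite /send_weight (negbTE ik).
Qed.

Lemma q_ka_le1 : q <= 1.
Proof.
have /andP[a0 a1] := alpha01.
rewrite -sum_send_weight -p1; apply: ler_sum => i _; rewrite /send_weight.
by case: ifPn => // _; rewrite ler_piMl.
Qed.

(** A nonincreasing pmf charges its first point, which is always selected as k > 0; this covers
    alpha = 0. *)
Lemma q_ka_gt0 : 0 < q.
Proof.
have /andP[a0 a1] := alpha01.
have w0 i : 0 <= send_weight i by rewrite /send_weight; case: ifPn => // _; exact: mulr_ge0.
have n0 : (0 < n)%N := leq_trans k0 kn.
pose i0 := Ordinal n0.
have pi0 : 0 < p i0.
  rewrite lt_neqAle p0 andbT eq_sym; apply/eqP => pi0.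
  have : \sum_(i < n) p i = 0.
    apply: big1 => i _; apply/eqP; rewrite eq_le p0 andbT -pi0.
    exact: p_nincr.
  by rewrite p1 => /eqP; rewrite oner_eq0.
rewrite -sum_send_weight (bigD1 i0)//= ltr_pwDl//; first by rewrite /send_weight /= k0.
exact: sumr_ge0.
Qed.

Let q0 := q_ka_gt0.

Let q_p_alpha i : q * p_alpha k p alpha i = send_weight i.
Proof.
by rewrite /p_alpha /send_weight; case: ifPn => _; field; rewrite gt_eqF.
Qed.

Lemma integral_selected_mark j (r : 'I_n -> R) :
  (\int[P]_w (((selected k (X^~ w) (C^~ w) j)%:R : R) * r (X j w))%:E =
   (\sum_(i < n) send_weight i * r i)%:E)%E.
Proof.
(* The event that packet j carries i and is selected; the coin matters only for i beyond the first
   k. These events are disjoint. *)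
pose E (i : 'I_n) := if (i < k)%N then [set w | X j w = i]
                     else [set w | X j w = i] `&` [set w | C j w].
have mE i : measurable (E i) by rewrite /E; case: ifPn => // _; exact: measurableI.
have PE i : P (E i) = (send_weight i)%:E.
  rewrite /E /send_weight; case: ifPn => // _.
  have := indep (JA := [::]) (JX := [:: j]) (JC := [:: j]) (B := fun=> setT)
    (fun=> [set i]) (fun=> [set true]) isT isT isT (fun=> measurableT).
  rewrite !big_nil !big_seq1 setTI mul1e.
  rewrite (_ : X j @^-1` _ = [set w | X j w = i])//.
  rewrite (_ : C j @^-1` _ = [set w | C j w]); last by apply/seteqP; split => w /=.
  by move=> ->; rewrite X_pmf C_prob -EFinM mulrC.
have eqE w : (((selected k (X^~ w) (C^~ w) j)%:R : R) * r (X j w))%:E =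
    (\sum_(i < n) (r i)%:E * (\1_(E i) w)%:E)%E.
  rewrite (bigD1 (X j w))//= big1 ?adde0; last first.
    move=> i iX; rewrite indicE memNset ?mule0// /E; case: ifPn => _ /=.
      by move=> Xi; move: iX; rewrite Xi eqxx.
    by move=> [Xi _]; move: iX; rewrite Xi eqxx.
  rewrite -EFinM mulrC; congr (_ * _)%:E; rewrite indicE /selected /E.
  case: ifPn => Xk /=; first by rewrite mem_set.
  case: (boolP (C j w)) => Cw; first by rewrite mem_set.
  by rewrite memNset//= => -[_]; apply/negP.
under eq_integral do rewrite eqE.
have iE i : P.-integrable setT (fun w => (\1_(E i) w)%:E) by exact: integrable_indic.
rewrite integral_sum//; last by move=> i; apply: integrableZl.
rewrite -sumEFin; apply: eq_bigr => i _.
have intE : (\int[P]_w (\1_(E i) w)%:E = (send_weight i)%:E)%E.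
  by rewrite integral_indic// setIT; exact: PE.
by rewrite integralZl// intE -EFinM mulrC.
Qed.

Lemma integral_prob_cst (c : R) : (\int[P]__ c%:E = c%:E)%E.
Proof.
rewrite integral_cst//; transitivity (c%:E * 1)%E; last exact: mule1.
by congr (_ * _)%E; exact: probability_setT.
Qed.

Definition mark_bound (rho : 'I_n -> bool -> R) : R :=
  \sum_(i < n) (`|rho i true| + `|rho i false|).

Lemma mark_boundP rho x c : `|rho x c| <= mark_bound rho.
Proof.
rewrite /mark_bound (bigD1 x)//= -addrA.
have s0 : 0 <= \sum_(i < n | i != x) (`|rho i true| + `|rho i false|).
  by apply: sumr_ge0 => i _; exact: addr_ge0.
have := normr_ge0 (rho x true); have := normr_ge0 (rho x false).
by case: c => *; lra.
Qed.

Let mmark j (rho : 'I_n -> bool -> R) := measurable_mark mA mX mC j rho.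

Lemma integrable_mark j rho : P.-integrable setT (fun w => (rho (X j w) (C j w))%:E).
Proof.
apply: (@le_integrable _ _ _ _ _ measurableT _ (cst (mark_bound rho)%:E)).
- exact/measurable_EFinP.
- by move=> w _; rewrite /= lee_fin (le_trans (mark_boundP _ _ _))// ler_norm.
- exact: finite_measure_integrable_cst.
Qed.

Local Notation EL := (EL k p alpha len).
Local Notation EL2 := (EL2 k p alpha len).
Let sel (x : 'I_n) (c : bool) : R := ((x < k)%N || c)%:R.

Lemma integral_selected_sub_q j :
  (\int[P]_w (sel (X j w) (C j w) - q)%:E = 0)%E.
Proof.
have hq : (\int[P]_w (sel (X j w) (C j w))%:E = q%:E)%E.
  transitivity (\sum_(i < n) send_weight i * 1)%:E.
    rewrite -(integral_selected_mark j (fun=> 1)).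
    by apply: eq_integral => w _; rewrite mulr1.
  by rewrite -mulr_suml mulr1 sum_send_weight.
have i1 := integrable_mark j sel.
under eq_integral do rewrite EFinB.
rewrite integralB//; last exact: finite_measure_integrable_cst.
by rewrite integral_prob_cst hq subee.
Qed.

Lemma integral_selected_centered j (r : 'I_n -> R) :
  (\int[P]_w (sel (X j w) (C j w) * (r (X j w) - \sum_(i < n) p_alpha k p alpha i * r i))%:E = 0)%E.
Proof.
rewrite (integral_selected_mark j (fun i => r i - \sum_(i < n) p_alpha k p alpha i * r i)).
under eq_bigr do rewrite mulrBr.
rewrite sumrB -mulr_suml sum_send_weight mulr_sumr.
under [X in _ - X]eq_bigr do rewrite mulrA q_p_alpha.
by rewrite subrr.
Qed.

Local Notation lagw j w := (lag k len (A^~ w) (X^~ w) (C^~ w) j).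
Local Notation lastw j w := (last_len k len (A^~ w) (X^~ w) (C^~ w) j).
Local Notation idle h j w := (when_idle k len (A^~ w) (X^~ w) (C^~ w) h j).
Local Notation wt j w := (idle_time k len (A^~ w) (X^~ w) (C^~ w) j).
Local Notation ep j w := (idle_prob k len (A^~ w) (X^~ w) (C^~ w) lambda j).
Local Notation TP j := (g_sigma_algebraType (past A X C j)).
Local Notation TA j := (g_sigma_algebraType (past_arrival A X C j)).

Let mem_iota0 i j : (i < j)%N -> i \in iota 0 j.
Proof. by rewrite mem_iota. Qed.

Let m_lag_last_past i j : (i <= j)%N ->
  measurable_fun [set: TP j] (fun w => lagw i w) /\
  measurable_fun [set: TP j] (fun w => lastw i w).
Proof.
move=> ij; apply: (@measurable_lag_last_len _ _ _ _ _ (TP j)).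
- by move=> l li; apply: measurable_cyl_A; apply: mem_iota0; exact: leq_trans li ij.
- by move=> l li dU U f; apply: measurable_cyl_XC; apply: mem_iota0; exact: leq_trans li ij.
Qed.

Let m_lag_last_arrival j :
  measurable_fun [set: TA j] (fun w => lagw j w) /\
  measurable_fun [set: TA j] (fun w => lastw j w).
Proof.
apply: (@measurable_lag_last_len _ _ _ _ _ (TA j)).
- by move=> l li; apply: measurable_cyl_A; apply: mem_iota0; exact: ltnW.
- by move=> l li dU U f; apply: measurable_cyl_XC; apply: mem_iota0.
Qed.

Let m_when_idle (h : R -> R) : measurable_fun setT h ->
  measurable_fun [set: R * R] (fun x => if 0 <= x.1 + x.2 then h (x.1 + x.2) else 0).
Proof.
move=> mh; have ms : measurable_fun [set: R * R] (fun x : R * R => x.1 + x.2).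
  exact: measurable_funD.
apply: measurable_fun_ifT => //; first exact: measurable_fun_ler.
exact: measurableT_comp mh ms.
Qed.

Let m_idle_gen {d' : measure_display} {T' : measurableType d'} (u a : T' -> R) (h : R -> R) :
  measurable_fun setT u -> measurable_fun setT a -> measurable_fun setT h ->
  measurable_fun setT (fun w => if 0 <= u w + a w then h (u w + a w) else 0).
Proof.
move=> mu_ ma mh; exact: measurableT_comp (m_when_idle mh) (measurable_fun_pair mu_ ma).
Qed.

Let m_idle_arrival (h : R -> R) j : measurable_fun setT h ->
  measurable_fun [set: TA j] (fun w => idle h j w).
Proof.
move=> mh; apply: m_idle_gen => //; first exact: (m_lag_last_arrival j).1.
by apply: measurable_cyl_A; exact: mem_iota0.
Qed.

Let m_idle_past (h : R -> R) i j : (i < j)%N -> measurable_fun setT h ->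
  measurable_fun [set: TP j] (fun w => idle h i w).
Proof.
move=> ij mh; apply: m_idle_gen => //; first exact: (m_lag_last_past (ltnW ij)).1.
by apply: measurable_cyl_A; exact: mem_iota0.
Qed.

Let m_wt_past i j : (i <= j)%N -> measurable_fun [set: TP j] (fun w => wt i w).
Proof. by move=> ij; apply: measurable_maxr => //; exact: (m_lag_last_past ij).1. Qed.

Let m_ep_past i j : (i <= j)%N -> measurable_fun [set: TP j] (fun w => ep i w).
Proof.
move=> ij; apply: measurableT_comp => //; apply: measurable_funM => //.
by apply: measurable_maxr => //; apply: measurableT_comp => //; exact: (m_lag_last_past ij).1.
Qed.

Let m_idle_T (h : R -> R) j : measurable_fun setT h -> measurable_fun [set: T] (fun w => idle h j w).
Proof. by move=> mh; exact: (measurable_past_arrival_T mA mX mC (m_idle_arrival mh)). Qed.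
Let m_wt_T j : measurable_fun [set: T] (fun w => wt j w).
Proof. exact: (measurable_past_T mA mX mC (m_wt_past (leqnn j))). Qed.
Let m_ep_T j : measurable_fun [set: T] (fun w => ep j w).
Proof. exact: (measurable_past_T mA mX mC (m_ep_past (leqnn j))). Qed.

(** Half of the rate q lambda of the full idle period. Any theta < q lambda makes [ratio * (1 - q)]
    less than 1, the contraction behind [exp_moment]. *)
Let theta := q * lambda / 2.
Let theta0 : 0 < theta. Proof. by rewrite divr_gt0// mulr_gt0. Qed.
Let theta_lt : theta < lambda.
Proof. by rewrite /theta; have := q_ka_le1; have := lambda0; nra. Qed.
Let expt (y : R) := expR (theta * y).
Let expt_gt0 y : 0 < expt y. Proof. exact: expR_gt0. Qed.
Let expt_ge1 y : 0 <= y -> 1 <= expt y.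
Proof. by move=> y0; rewrite -expR0 ler_expR mulr_ge0// ltW. Qed.
Let ratio := lambda / (lambda - theta).
Let ratio_gt0 : 0 < ratio. Proof. by rewrite divr_gt0// subr_gt0. Qed.

Let expt_ge0 y : 0 <= expt y. Proof. exact: ltW. Qed.
Let ratio_ge0 : 0 <= ratio. Proof. exact: ltW. Qed.
Let ratio_expt_ge0 y : 0 <= ratio * expt y. Proof. exact: mulr_ge0. Qed.

Let mexpt : measurable_fun setT expt.
Proof. by apply: measurableT_comp => //; exact: measurable_funM. Qed.

Let wt_ge0 j w : 0 <= wt j w. Proof. by rewrite /idle_time le_max lexx orbT. Qed.
Let ep_ge0 j w : 0 <= ep j w. Proof. exact: expR_ge0. Qed.
Let ep_le1 j w : ep j w <= 1.
Proof.
by rewrite -expR0 ler_expR mulNr oppr_le0 mulr_ge0 ?(ltW lambda0)// le_max lexx orbT.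
Qed.

Let idle_expt_ge0 j w : 0 <= idle expt j w.
Proof. by rewrite /when_idle; case: ifPn => // _; exact: ltW. Qed.

Let shift_expt z j :
  (\int[P]_w (if 0 <= z + A j w then expt (z + A j w) else 0)%:E =
   (ratio * expt (Num.max z 0) * expR (- lambda * Num.max (- z) 0))%:E)%E.
Proof.
have dexp (y : R) : is_derive y 1 expt (theta * expt y) by exact: is_derive_expR_scale.
have dF (y : R) : is_derive y 1 (fun y => ratio * expt y) (lambda * (ratio * expt y - expt y)).
  have -> : lambda * (ratio * expt y - expt y) = ratio * (theta * expt y) + expt y * 0.
    by rewrite /ratio; field; rewrite subr_eq0 gt_eqF.
  exact: is_derive_mul (is_derive_cst ratio y 1) (dexp y).
apply: (integral_exponential_shift lambda0 (mA j) (A_cdf j) z _ _ dF theta_lt (c := ratio)).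
- by move=> y _; exact: ltW.
- exact: is_derive_continuous dexp.
- by move=> y _; rewrite ger0_norm.
Qed.

Let integral_idle_expt j :
  (\int[P]_w (idle expt j w)%:E = \int[P]_w (ratio * expt (wt j w) * ep j w)%:E)%E.
Proof.
transitivity (\int[P]_w \int[P]_w'
    (if 0 <= lagw j w + A j w' then expt (lagw j w + A j w') else 0)%R%:E)%E.
  apply: (ge0_integral_freeze_arrival mA mX mC indep (m_when_idle mexpt)
    (m_lag_last_past (leqnn j)).1
    (g := fun z a => if 0 <= z + a then expt (z + a) else 0)).
  by move=> z a; case: ifPn => // _; exact: ltW.
by apply: eq_integral => w _; exact: shift_expt.
Qed.

Let integral_sel j : (\int[P]_w (1 - sel (X j w) (C j w))%:E = (1 - q)%:E)%E.
Proof.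
have h := integral_selected_sub_q j.
have i1 : P.-integrable setT (fun w => (sel (X j w) (C j w) - q)%:E).
  exact: (integrable_mark j (fun x c => sel x c - q)).
transitivity (\int[P]_w ((1 - q)%:E - (sel (X j w) (C j w) - q)%:E))%E.
  by apply: eq_integral => w _; rewrite -EFinB; congr EFin; ring.
rewrite integralB//; last exact: finite_measure_integrable_cst.
by rewrite h integral_prob_cst sube0.
Qed.

Let idle_moment_step j (K : R) :
  (\int[P]_w (expt (wt j w))%:E <= K%:E ->
   \int[P]_w (idle expt j w)%:E <= (ratio * K)%:E)%E.
Proof.
move=> hK; rewrite integral_idle_expt.
apply: (@le_trans _ _ (\int[P]_w (ratio%:E * (expt (wt j w))%:E))%E).
  apply: ge0_le_integral => //.
  - by move=> w _; rewrite lee_fin; exact: mulr_ge0.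
  - apply/measurable_EFinP; apply: measurable_funM => //.
    by apply: measurable_funM => //; exact: measurableT_comp.
  - by apply/measurable_EFinP; apply: measurable_funM => //; exact: measurableT_comp.
  - by move=> w _; rewrite -EFinM lee_fin ler_piMr.
rewrite ge0_integralZl_EFin//.
- by rewrite [leRHS]EFinM lee_wpmul2l// lee_fin.
- by move=> w _; rewrite lee_fin.
- by apply/measurable_EFinP; exact: measurableT_comp.
Qed.

(** Only a discarded packet carries idle time on, so the moment at j + 1 is at most 1 + ratio (1 -
    q) times the moment at j. Here ratio (1 - q) = 2 (1 - q) / (2 - q) < 1, with fixed point 2 / q -
    1, just below the bound 2 / q. *)
Let exp_moment j : (\int[P]_w (expt (wt j w))%:E <= (2 / q)%:E)%E.
Proof.
have q1 := q_ka_le1.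
elim: j => [|j IH].
  under eq_integral do rewrite /idle_time /= maxxx /expt mulr0 expR0.
  by rewrite integral_prob_cst lee_fin ler_pdivlMr// mul1r; lra.
have mv := @m_idle_arrival expt j mexpt.
have hI := idle_moment_step IH.
apply: (@le_trans _ _ (\int[P]_w (1%:E + (idle expt j w * (1 - sel (X j w) (C j w)))%:E))%E).
  apply: ge0_le_integral => //.
  - by move=> w _; rewrite lee_fin.
  - by apply/measurable_EFinP; exact: measurableT_comp.
  - apply/measurable_EFinP; apply: measurable_funD => //; apply: measurable_funM.
      exact: m_idle_T.
    exact: (mmark j (fun x c => 1 - sel x c)).
  - move=> w _; rewrite -EFinD lee_fin idle_timeS /when_idle /sel.
    rewrite /selected; case: ifPn => y0; case: (_ || _) => /=;
      rewrite ?subrr ?subr0 ?mulr0 ?mul0r ?mulr1 /expt ?mulr0 ?expR0 ?addr0//.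
    by rewrite lerDr.
rewrite ge0_integralD//; last 2 first.
- move=> w _; rewrite lee_fin mulr_ge0// subr_ge0 /sel; by case: (_ || _).
- apply/measurable_EFinP; apply: measurable_funM; first exact: m_idle_T.
  exact: (mmark j (fun x c => 1 - sel x c)).
rewrite integral_prob_cst.
rewrite (ge0_integral_freeze_mark mA mX mC indep (rho := fun x c => 1 - sel x c) mv)//; last first.
  by move=> x c; rewrite subr_ge0 /sel; case: (_ || _).
rewrite integral_sel.
apply: (@le_trans _ _ (1%:E + (ratio * (2 / q))%:E * (1 - q)%:E)%E).
  by rewrite leeD2l// lee_wpmul2r// lee_fin subr_ge0.
rewrite -EFinM -EFinD lee_fin /ratio /theta.
have l1 : 0 < lambda := lambda0.
rewrite -subr_ge0.
have -> : 2 / q - (1 + lambda / (lambda - q * lambda / 2) * (2 / q) * (1 - q)) =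
    q / (2 - q).
  by field; rewrite !gt_eqF//=; [nra|lra].
by rewrite divr_ge0 ?ltW//; lra.
Qed.

Let idle_exp_moment j : (\int[P]_w (idle expt j w)%:E <= (4 / q)%:E)%E.
Proof.
have q1 := q_ka_le1.
apply: le_trans (idle_moment_step (exp_moment j)) _.
rewrite lee_fin (_ : 4 / q = 2 * (2 / q)); last by field; rewrite gt_eqF.
apply: ler_wpM2r; first by rewrite divr_ge0// ltW.
by rewrite /ratio ler_pdivrMr ?subr_gt0// /theta; have := lambda0; nra.
Qed.

Lemma second_moment_le (f : T -> R) (c : R) j : measurable_fun setT f -> 0 <= c ->
  (forall w, f w ^+ 2 <= c * (idle expt j w + expt (wt j w))) ->
  (\int[P]_w (f w ^+ 2)%:E <= (c * (6 / q))%:E)%E.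
Proof.
move=> mf c0 fc.
have m1 : measurable_fun setT (fun w => idle expt j w) by exact: m_idle_T.
have m2 : measurable_fun setT (fun w => expt (wt j w)) by exact: measurableT_comp.
apply: (@le_trans _ _ (\int[P]_w (c%:E * ((idle expt j w)%:E + (expt (wt j w))%:E)))%E).
  apply: ge0_le_integral => //.
  - by move=> w _; rewrite lee_fin sqr_ge0.
  - by apply/measurable_EFinP; exact: measurable_funX.
  - by apply/measurable_EFinP; apply: measurable_funM => //; exact: measurable_funD.
  - by move=> w _; rewrite -EFinD -EFinM lee_fin.
rewrite ge0_integralZl_EFin//; last 2 first.
- by move=> w _; rewrite -EFinD lee_fin addr_ge0.
- by apply/measurable_EFinP; exact: measurable_funD.
rewrite EFinM lee_wpmul2l ?lee_fin// ge0_integralD//; last 4 first.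
- by move=> w _; rewrite lee_fin.
- exact/measurable_EFinP.
- by move=> w _; rewrite lee_fin.
- exact/measurable_EFinP.
apply: le_trans (leeD (idle_exp_moment j) (exp_moment j)) _.
by rewrite -EFinD lee_fin -mulrDl; lra.
Qed.

(** From (1 + y^2)^2 <= 2 (1 + y^4) and the fourth-order term (theta y)^4 / 4! of the exponential
    series. *)
Let c1 := 2 * (1 + 24 / theta ^+ 4).
Let c1_ge0 : 0 <= c1.
Proof. by rewrite mulr_ge0// addr_ge0// divr_ge0// exprn_ge0// ltW. Qed.

Let quad_sqr_le (y : R) : 0 <= y -> (1 + y ^+ 2) ^+ 2 <= c1 * expt y.
Proof.
move=> y0; have ty : 0 <= theta * y by rewrite mulr_ge0// ltW.
have := expR_ge1Dxn 3 ty; rewrite -/(expt y) => h.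
have e1 := expt_ge1 y0.
have th4 : 0 < theta ^+ 4 by exact: exprn_gt0.
have y4 : y ^+ 4 <= 24 / theta ^+ 4 * expt y.
  rewrite mulrAC ler_pdivlMr// -exprMn [y * _]mulrC.
  by move: h; rewrite (_ : 4`!%:R = 24 :> R)//; lra.
have y2 : 2 * y ^+ 2 <= 1 + y ^+ 4.
  rewrite -subr_ge0; have -> : 1 + y ^+ 4 - 2 * y ^+ 2 = (1 - y ^+ 2) ^+ 2 by ring.
  exact: sqr_ge0.
have -> : (1 + y ^+ 2) ^+ 2 = 1 + 2 * y ^+ 2 + y ^+ 4 by ring.
rewrite /c1 -mulrA mulrDl mul1r; lra.
Qed.

Definition quad_bounded (a : R) (f : R -> R) :=
  forall y, 0 <= y -> `|f y| <= a * (1 + y ^+ 2).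

Let quad_bounded_sqr a f y : 0 <= a -> quad_bounded a f -> 0 <= y ->
  f y ^+ 2 <= a ^+ 2 * c1 * expt y.
Proof.
move=> a0 fa y0; rewrite -real_normK ?num_real//.
apply: (@le_trans _ _ ((a * (1 + y ^+ 2)) ^+ 2)).
  by rewrite ler_sqr ?nnegrE ?fa// mulr_ge0// addr_ge0// sqr_ge0.
by rewrite exprMn -mulrA ler_wpM2l ?sqr_ge0// quad_sqr_le.
Qed.

Let quad_bounded_exp a f y : 0 <= a -> quad_bounded a f -> 0 <= y ->
  `|f y| <= a * c1 * expt y.
Proof.
move=> a0 fa y0; apply: le_trans (fa _ y0) _.
rewrite -mulrA ler_wpM2l//; apply: le_trans (quad_sqr_le y0).
by rewrite expr2 ler_peMr ?lerDl ?sqr_ge0// addr_ge0// sqr_ge0.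
Qed.

Let idle_sqr_le a h j w : 0 <= a -> quad_bounded a h ->
  idle h j w ^+ 2 <= a ^+ 2 * c1 * idle expt j w.
Proof.
move=> a0 ha; rewrite /when_idle; case: ifPn => [y0|_]; first exact: quad_bounded_sqr.
by rewrite expr0n mulr0.
Qed.

Let cK_ge0 (M a : R) : 0 <= M ^+ 2 * (a ^+ 2 * c1).
Proof. exact: mulr_ge0 (sqr_ge0 _) (mulr_ge0 (sqr_ge0 _) c1_ge0). Qed.

Let integrable_sqr (f : T -> R) (K : R) : measurable_fun setT f ->
  (\int[P]_w (f w ^+ 2)%:E <= K%:E)%E -> P.-integrable setT (fun w => (f w ^+ 2)%:E).
Proof.
move=> mf fK; apply/integrableP; split.
  by apply/measurable_EFinP; exact: measurable_funX.
under eq_integral do rewrite gee0_abs ?lee_fin ?sqr_ge0//.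
exact: le_lt_trans fK (ltry _).
Qed.

Let sqr_mul_le (x y M c : R) : `|x| <= M -> y ^+ 2 <= c ->
  (x * y) ^+ 2 <= M ^+ 2 * c.
Proof.
move=> xM yc; rewrite exprMn ler_pM ?sqr_ge0//.
rewrite -real_normK ?num_real// ler_sqr ?nnegrE//.
exact: le_trans xM.
Qed.

Section ArrivalAverages.
Variables (phi : nat -> T -> R) (M : R) (h F : R -> R) (a : R).
Hypothesis mphi : forall i j, (i <= j)%N -> measurable_fun [set: TP j] (phi i).
Hypothesis phiM : forall j w, `|phi j w| <= M.
Hypotheses (a0 : 0 <= a) (h0 : forall y, 0 <= y -> 0 <= h y) (ch : continuous h).
Hypothesis dF : forall y : R, is_derive y 1 F (lambda * (F y - h y)).
Hypotheses (ha : quad_bounded a h) (Fa : quad_bounded a F).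

(** A martingale difference: [F (wt j w) * ep j w] is the conditional mean of [idle h j] given
    [past j], and the weight [phi j] is determined by that past. *)
Let xi j w := phi j w * (idle h j w - F (wt j w) * ep j w).
Let g (z x : R) := (if 0 <= z + x then h (z + x) else 0) -
  F (Num.max z 0) * expR (- lambda * Num.max (- z) 0).

Let mh : measurable_fun setT h. Proof. exact: continuous_measurable_fun. Qed.
Let mF : measurable_fun setT F.
Proof. exact: continuous_measurable_fun (is_derive_continuous dF). Qed.

Let mxi_past i j : (i < j)%N -> measurable_fun [set: TP j] (xi i).
Proof.
move=> ij; have ij' := ltnW ij.
apply: measurable_funM; first exact: mphi.
apply: measurable_funB; first exact: m_idle_past.
apply: measurable_funM; last exact: m_ep_past.
exact: measurableT_comp mF (m_wt_past ij').
Qed.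

Let mxi j : measurable_fun [set: T] (xi j).
Proof. exact: (measurable_past_T mA mX mC (mxi_past (ltnSn j))). Qed.

Let xi_moment j :
  (\int[P]_w (xi j w ^+ 2)%:E <= (2 * (M ^+ 2 * (a ^+ 2 * c1)) * (6 / q))%:E)%E.
Proof.
apply: (second_moment_le (j := j)) => //; first exact: mulr_ge0.
move=> w; rewrite -mulrA mulrCA -[M ^+ 2 * _ * _]mulrA; apply: sqr_mul_le => //.
have i2 := idle_sqr_le j w a0 ha.
have f2 : (F (wt j w) * ep j w) ^+ 2 <= a ^+ 2 * c1 * expt (wt j w).
  rewrite exprMn; apply: (@le_trans _ _ (F (wt j w) ^+ 2)).
    by rewrite ler_piMr ?sqr_ge0// expr_le1.
  exact: quad_bounded_sqr.
move: (idle h j w) (F (wt j w) * ep j w) i2 f2 => x y i2 f2.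
have xy := sqr_ge0 (x + y).
have -> : (x - y) ^+ 2 = 2 * x ^+ 2 + 2 * y ^+ 2 - (x + y) ^+ 2 by ring.
rewrite mulrDr; lra.
Qed.

Let xi_sqr j := integrable_sqr (mxi j) (xi_moment j).

Let mg : measurable_fun [set: R * R] (fun x => g x.1 x.2).
Proof.
apply: measurable_funB; first exact: m_when_idle.
apply: measurable_funM.
  by apply: measurableT_comp mF _; exact: measurable_maxr.
apply: measurableT_comp => //; apply: measurable_funM => //.
by apply: measurable_maxr => //; exact: measurableT_comp.
Qed.

Let shift z j : (\int[P]_w (if 0 <= z + A j w then h (z + A j w) else 0)%:E =
   (F (Num.max z 0) * expR (- lambda * Num.max (- z) 0))%:E)%E.
Proof.
apply: (integral_exponential_shift lambda0 (mA j) (A_cdf j) z h0 ch dF theta_lt (c := a * c1)).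
by move=> y y0; exact: quad_bounded_exp.
Qed.

Let integrable_shift z j :
  P.-integrable setT (fun w => (if 0 <= z + A j w then h (z + A j w) else 0)%:E).
Proof.
apply/integrableP; split.
  by apply/measurable_EFinP; apply: m_idle_gen.
under eq_integral.
  move=> w _; rewrite gee0_abs; last by rewrite lee_fin; case: ifPn => // /h0.
  over.
by rewrite shift ltry.
Qed.

Let xi_orth i j : (i < j)%N -> (\int[P]_w (xi i w * xi j w)%:E = 0)%E.
Proof.
move=> ij.
have E w : xi i w * xi j w = xi i w * phi j w * g (lagw j w) (A j w).
  by rewrite {2}/xi mulrA.
under eq_integral do rewrite E.
apply: (integral_freeze_arrival mA mX mC indep mg (m_lag_last_past (leqnn j)).1).
- by apply: measurable_funM; [exact: mxi_past|exact: mphi].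
- move=> z; rewrite /g; under eq_fun do rewrite EFinB.
  by apply: integrableB => //; exact: finite_measure_integrable_cst.
- move=> z; rewrite /g; under eq_integral do rewrite EFinB.
  rewrite integralB//; last exact: finite_measure_integrable_cst.
  by rewrite shift integral_prob_cst subee.
- by under eq_fun do rewrite -E; exact: integrable_mul_of_sqr.
Qed.

Lemma ae_avg0_arrival : {ae P, forall w, avg0 (xi^~ w)}.
Proof. exact: (strong_law_orthogonal mxi xi_moment xi_orth). Qed.

End ArrivalAverages.

Section MarkAverages.
Variables (phi : nat -> T -> R) (M : R) (h : R -> R) (a : R) (rho : 'I_n -> bool -> R).
Hypothesis mphi : forall i j, (i <= j)%N -> measurable_fun [set: TP j] (phi i).
Hypothesis phiM : forall j w, `|phi j w| <= M.
Hypotheses (a0 : 0 <= a) (ch : continuous h) (ha : quad_bounded a h).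
Hypothesis rho0 : forall j, (\int[P]_w (rho (X j w) (C j w))%:E = 0)%E.

(** A martingale difference again: everything before [rho] is determined by [past_arrival j], of
    which the centred mark j is independent. *)
Let xi j w := phi j w * idle h j w * rho (X j w) (C j w).

Let mh : measurable_fun setT h. Proof. exact: continuous_measurable_fun. Qed.

Let past_sub_arrival j (f : T -> R) :
  measurable_fun [set: TP j] f -> measurable_fun [set: TA j] f.
Proof.
move=> mf _ B mB; have := mf (@measurableT _ _) B mB.
apply: smallest_sub; first exact: (@sigma_algebra_measurable _ (TA j)).
move=> _ [B' [S [D [mB' ->]]]]; apply: sub_sigma_algebra.
exists (fun i => if (i < j)%N then B' i else setT), S, D.
split; first by move=> i; case: ifP.
apply/seteqP; split => w /rectangleP[b s c]; apply/rectangleP; split => // i.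
  by rewrite mem_iota /= add0n => _; case: ifPn => // ij; apply: b; rewrite mem_iota.
rewrite mem_iota /= add0n => ij; have := b i; rewrite ij; apply.
by rewrite mem_iota /= add0n ltnW.
Qed.

Let mxi_past i j : (i < j)%N -> measurable_fun [set: TP j] (xi i).
Proof.
move=> ij; apply: measurable_funM; last by apply: measurable_cyl_XC; exact: mem_iota0.
by apply: measurable_funM; [apply: mphi; exact: ltnW|exact: m_idle_past].
Qed.

Let mxi j : measurable_fun [set: T] (xi j).
Proof. exact: (measurable_past_T mA mX mC (mxi_past (ltnSn j))). Qed.

Let xi_moment j : (\int[P]_w (xi j w ^+ 2)%:E <=
  ((M * mark_bound rho) ^+ 2 * (a ^+ 2 * c1) * (6 / q))%:E)%E.
Proof.
apply: (second_moment_le (j := j)) => // w.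
rewrite -mulrA /xi mulrAC; apply: sqr_mul_le.
  by rewrite normrM ler_pM// mark_boundP.
apply: le_trans (idle_sqr_le j w a0 ha) _.
by rewrite ler_wpM2l ?lerDl//; exact: mulr_ge0 (sqr_ge0 _) c1_ge0.
Qed.

Let xi_sqr j := integrable_sqr (mxi j) (xi_moment j).

Let xi_orth i j : (i < j)%N -> (\int[P]_w (xi i w * xi j w)%:E = 0)%E.
Proof.
move=> ij.
have E w : xi i w * xi j w = xi i w * (phi j w * idle h j w) * rho (X j w) (C j w).
  by rewrite {2}/xi mulrA.
under eq_integral do rewrite E.
apply: (integral_freeze_mark mA mX mC indep).
- apply: measurable_funM; first by apply: past_sub_arrival; exact: mxi_past.
  apply: measurable_funM; first by apply: past_sub_arrival; exact: mphi.
  exact: m_idle_arrival.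
- exact: integrable_mark.
- exact: rho0.
- by under eq_fun do rewrite -E; exact: integrable_mul_of_sqr.
Qed.

Lemma ae_avg0_mark : {ae P, forall w, avg0 (xi^~ w)}.
Proof. exact: (strong_law_orthogonal mxi xi_moment xi_orth). Qed.

End MarkAverages.

Let mu := lambda^-1.
Let mu0 : 0 < mu. Proof. by rewrite invr_gt0. Qed.
(** One constant large enough for 1, y, y^2 and their conditional means [F1], [F2] to be at most
    growth (1 + y^2). *)
Let growth := 1 + 2 * mu + 2 * mu ^+ 2.
Let growth_ge1 : 1 <= growth.
Proof. by rewrite /growth; have := sqr_ge0 mu; have := mu0; lra. Qed.
Let growth_ge0 : 0 <= growth. Proof. exact: le_trans growth_ge1. Qed.

Let sqr (y : R) := y ^+ 2.
(** [F1] and [F2] are the means of y + W and (y + W)^2 for W exponential of rate lambda, i.e. the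
    polynomial solutions of F' = lambda (F - h). *)
Let F1 (y : R) := y + mu.
Let F2 (y : R) := y ^+ 2 + 2 * mu * y + 2 * mu ^+ 2.

Let quad_bounded_of f : (forall y, 0 <= y -> 0 <= f y <= growth * (1 + y ^+ 2)) ->
  quad_bounded growth f.
Proof. by move=> hf y /hf/andP[f0 fg]; rewrite ger0_norm. Qed.

Let quad_cst1 : quad_bounded growth (cst 1).
Proof.
apply: quad_bounded_of => y y0; rewrite ler01/=; have := growth_ge1; have := sqr_ge0 y; nra.
Qed.

Let quad_id : quad_bounded growth id.
Proof.
apply: quad_bounded_of => y y0; rewrite y0/=.
have g1 := growth_ge1; have y2 := sqr_ge0 y; have y1 := sqr_ge0 (y - 1).
apply: (@le_trans _ _ (1 * (1 + y ^+ 2))); last by rewrite ler_wpM2r//; lra.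
by rewrite mul1r; nra.
Qed.

Let quad_sqr : quad_bounded growth sqr.
Proof.
apply: quad_bounded_of => y y0; rewrite sqr_ge0/= /sqr.
have g1 := growth_ge1; have y2 := sqr_ge0 y.
apply: (@le_trans _ _ (1 * (1 + y ^+ 2))); last by rewrite ler_wpM2r//; lra.
by rewrite mul1r; lra.
Qed.

Let quad_F1 : quad_bounded growth F1.
Proof.
have m0 := mu0; apply: quad_bounded_of => y y0; apply/andP; split; rewrite /F1; first by lra.
have y2 := sqr_ge0 y; have y1 := sqr_ge0 (y - 1); have m2 := sqr_ge0 mu.
have my : 0 <= mu * y ^+ 2 by rewrite mulr_ge0// ltW.
have my2 : 0 <= mu ^+ 2 * y ^+ 2 by rewrite mulr_ge0.
have -> : growth * (1 + y ^+ 2) = 1 + y ^+ 2 + 2 * mu + 2 * (mu * y ^+ 2) +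
  2 * mu ^+ 2 + 2 * (mu ^+ 2 * y ^+ 2) by rewrite /growth; ring.
nra.
Qed.

Let quad_F2 : quad_bounded growth F2.
Proof.
have m0 := mu0; apply: quad_bounded_of => y y0.
have y2 := sqr_ge0 y; have m2 := sqr_ge0 mu.
have my1 : 0 <= mu * y by rewrite mulr_ge0// ltW.
have my : 0 <= mu * (y - 1) ^+ 2 by rewrite mulr_ge0 ?sqr_ge0// ltW.
have my2 : 0 <= mu ^+ 2 * y ^+ 2 by rewrite mulr_ge0.
have my3 : 0 <= mu * y ^+ 2 by rewrite mulr_ge0// ltW.
apply/andP; split; rewrite /F2; first by rewrite -!mulrA; lra.
have -> : growth * (1 + y ^+ 2) = y ^+ 2 + 2 * mu * y + 2 * mu ^+ 2 +
  (1 + 2 * (mu ^+ 2 * y ^+ 2) + mu * (y - 1) ^+ 2 + mu + mu * y ^+ 2).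
  by rewrite /growth; ring.
lra.
Qed.

Let d0 (y : R) : is_derive y 1 (cst 1 : R -> R) (lambda * (cst 1 y - cst 1 y)).
Proof. by rewrite subrr mulr0; exact: is_derive_cst. Qed.

Let d1 (y : R) : is_derive y 1 F1 (lambda * (F1 y - id y)).
Proof.
have -> : lambda * (F1 y - id y) = 1 + 0 by rewrite /F1 /mu /=; field; rewrite gt_eqF.
exact: is_deriveD (is_derive_id y 1) (is_derive_cst mu y 1).
Qed.

Let did (y : R) : is_derive y 1 (id : R -> R) 1. Proof. exact: is_derive_id. Qed.
Let dsqr (y : R) : is_derive y 1 sqr (y * 1 + y * 1).
Proof. exact: is_derive_mul (did y) (did y). Qed.

Let d2 (y : R) : is_derive y 1 F2 (lambda * (F2 y - sqr y)).
Proof.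
have -> : lambda * (F2 y - sqr y) =
    y * 1 + y * 1 + (2 * mu * 1 + y * 0) + 0.
  by rewrite /F2 /sqr /mu; field; rewrite gt_eqF.
apply: is_deriveD (is_deriveD (dsqr y) _) (is_derive_cst _ _ _).
exact: is_derive_mul (is_derive_cst (2 * mu) y 1) (did y).
Qed.

Let cont_cst1 : continuous (cst 1 : R -> R). Proof. exact: is_derive_continuous d0. Qed.
Let cont_id : continuous (id : R -> R). Proof. exact: is_derive_continuous did. Qed.
Let cont_sqr : continuous sqr. Proof. exact: is_derive_continuous dsqr. Qed.

(** Two weights are used: 1, and the previous codeword length [lastf] for the rectangular part of
    the area. *)
Let one (j : nat) (w : T) : R := 1.
Let m_one i j : (i <= j)%N -> measurable_fun [set: TP j] (one i).
Proof. by move=> _; exact: measurable_cst. Qed.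
Let one_bounded j w : `|one j w| <= 1. Proof. by rewrite normr1. Qed.
Let lastf (j : nat) (w : T) : R := lastw j w.
Let m_lastf i j : (i <= j)%N -> measurable_fun [set: TP j] (lastf i).
Proof. by move=> ij; exact: (m_lag_last_past ij).2. Qed.
Let lastf_bounded j w : `|lastf j w| <= max_len len.
Proof. by rewrite ger0_norm ?last_len_ge0// last_len_le. Qed.

Let ae_arrival_ge0 : {ae P, forall w, forall j, 0 <= A j w}.
Proof.
apply: ae_foralln => j; exists [set w | A j w <= 0]; split.
- by rewrite -[X in measurable X]setTI; exact: measurable_fun_le.
- transitivity ((1 - expR (- lambda * 0))%:E); first exact: A_cdf.
  by rewrite mulr0 expR0 subrr.
- by move=> w /= /negP; rewrite -ltNge => /ltW.
Qed.

Let ae_boundary (f : R -> R) : measurable_fun setT f -> quad_bounded growth f ->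
  {ae P, forall w, f (wt N w) / N.+1%:R @[N --> \oo] --> 0}.
Proof.
move=> mf qf; apply: (ae_cvg0_div_index (c := growth ^+ 2 * c1 * (6 / q))).
  by move=> N; exact: measurableT_comp.
move=> N; apply: (second_moment_le (j := N)).
- exact: measurableT_comp.
- exact: mulr_ge0 (sqr_ge0 _) c1_ge0.
- move=> w; apply: le_trans (quad_bounded_sqr growth_ge0 qf (wt_ge0 N w)) _.
  by apply: ler_wpM2l; [exact: mulr_ge0 (sqr_ge0 _) c1_ge0|rewrite lerDr].
Qed.

Let ae_idle_boundary : {ae P, forall w, idle id N w / N.+1%:R @[N --> \oo] --> 0}.
Proof.
apply: (ae_cvg0_div_index (c := growth ^+ 2 * c1 * (6 / q))).
  by move=> N; exact: m_idle_T.
move=> N; apply: (second_moment_le (j := N)).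
- exact: m_idle_T.
- exact: mulr_ge0 (sqr_ge0 _) c1_ge0.
- move=> w; apply: le_trans (idle_sqr_le N w growth_ge0 quad_id) _.
  by apply: ler_wpM2l; [exact: mulr_ge0 (sqr_ge0 _) c1_ge0|rewrite lerDl].
Qed.

Let cst1_nneg (y : R) : 0 <= y -> 0 <= (cst 1 y : R). Proof. by []. Qed.
Let id_nneg (y : R) : 0 <= y -> 0 <= id y. Proof. by []. Qed.
Let sqr_nneg (y : R) : 0 <= y -> 0 <= sqr y. Proof. by move=> _; exact: sqr_ge0. Qed.

Lemma ae_avg_age_cvg : {ae P, forall w,
  avg_age k len (A^~ w) (X^~ w) (C^~ w) t @[t --> +oo] -->
    (Delta_alpha k p alpha lambda len)%:E}.
Proof.
have /andP[al0 _] := alpha01.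
have EL_ge0 : 0 <= EL.
  apply: sumr_ge0 => i _; apply: mulr_ge0 => //; rewrite /p_alpha.
  by case: ifPn => _; rewrite divr_ge0 ?mulr_ge0// ltW.
have -> : Delta_alpha k p alpha lambda len =
    (EL2 + 2 * (lambda^-1 / q) * EL + 2 * (lambda^-1 / q) ^+ 2) /
      (2 * (EL + lambda^-1 / q)) + EL.
  rewrite /Delta_alpha; congr (_ / (2 * (EL + _)) + _); last by field; rewrite !gt_eqF.
  by congr (_ + _ * _ + _); field; rewrite !gt_eqF.
have rs := integral_selected_sub_q.
have rL j := integral_selected_centered j (fun i => (len i)%:R).
have rL2 j := integral_selected_centered j (fun i => (len i)%:R ^+ 2).
(* Five laws centre functions of the interarrival time and seven centre the selection or the
   codeword length; each holds off a null set. *)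
have II0 := ae_avg0_arrival m_one one_bounded growth_ge0 cst1_nneg cont_cst1 d0 quad_cst1 quad_cst1.
have II1 := ae_avg0_arrival m_one one_bounded growth_ge0 id_nneg cont_id d1 quad_id quad_F1.
have II2 := ae_avg0_arrival m_one one_bounded growth_ge0 sqr_nneg cont_sqr d2 quad_sqr quad_F2.
have IIl0 := ae_avg0_arrival m_lastf lastf_bounded growth_ge0 cst1_nneg cont_cst1 d0 quad_cst1 quad_cst1.
have IIl1 := ae_avg0_arrival m_lastf lastf_bounded growth_ge0 id_nneg cont_id d1 quad_id quad_F1.
have Is0 := ae_avg0_mark (rho := fun x c => sel x c - q) m_one one_bounded growth_ge0 cont_cst1 quad_cst1 rs.
have Is1 := ae_avg0_mark (rho := fun x c => sel x c - q) m_one one_bounded growth_ge0 cont_id quad_id rs.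
have Isl := ae_avg0_mark (rho := fun x c => sel x c - q) m_lastf lastf_bounded growth_ge0 cont_cst1 quad_cst1 rs.
have IL0 := ae_avg0_mark (rho := fun x c => sel x c * ((len x)%:R - EL)) m_one one_bounded growth_ge0 cont_cst1 quad_cst1 rL.
have IL1 := ae_avg0_mark (rho := fun x c => sel x c * ((len x)%:R - EL)) m_one one_bounded growth_ge0 cont_id quad_id rL.
have ILl := ae_avg0_mark (rho := fun x c => sel x c * ((len x)%:R - EL)) m_lastf lastf_bounded growth_ge0 cont_cst1 quad_cst1 rL.
have IL2 := ae_avg0_mark (rho := fun x c => sel x c * ((len x)%:R ^+ 2 - EL2)) m_one one_bounded growth_ge0 cont_cst1 quad_cst1 rL2.
have W1 := ae_boundary (@measurable_id _ _ _) quad_id.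
have msqr : measurable_fun setT sqr by exact: continuous_measurable_fun.
have W2 := ae_boundary msqr quad_sqr.
(* Finitely many almost sure events are intersected; from here on the argument concerns a single
   path. *)
near=> w.
apply: (avg_age_cvg_of_averages lambda0 q0 EL_ge0).
- by near: w.
- by near: w.
- by near: w.
- by near: w.
- by apply: (@eq_avg0 _ _ _ _ (near II0 w _)) => // j; rewrite mul1r mul1r.
- by apply: (@eq_avg0 _ _ _ _ (near II1 w _)) => // j; rewrite mul1r.
- by apply: (@eq_avg0 _ _ _ _ (near II2 w _)) => // j; rewrite mul1r.
- by apply: (@eq_avg0 _ _ _ _ (near IIl0 w _)) => // j; rewrite mul1r.
- by near: w.
- by apply: (@eq_avg0 _ _ _ _ (near Is0 w _)) => // j; rewrite mul1r.
- by apply: (@eq_avg0 _ _ _ _ (near Is1 w _)) => // j; rewrite mul1r.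
- by near: w.
- by apply: (@eq_avg0 _ _ _ _ (near IL0 w _)) => // j; rewrite mul1r.
- by apply: (@eq_avg0 _ _ _ _ (near IL1 w _)) => // j; rewrite mul1r.
- by near: w.
- by apply: (@eq_avg0 _ _ _ _ (near IL2 w _)) => // j; rewrite mul1r.
Unshelve. all: by end_near. Qed.

End UpdateSystem.

Theorem theorem2 (R : realType) (d : measure_display) (T : measurableType d)
  (P : probability T R) (n k : nat) (p : 'I_n -> R) (len : 'I_n -> nat)
  (alpha lambda : R)
  (A : nat -> T -> R) (X : nat -> T -> 'I_n) (C : nat -> T -> bool) :
  (0 < k)%N -> (k <= n)%N ->
  0 < lambda -> 0 <= alpha <= 1 ->
  (forall i, 0 <= p i) -> \sum_(i < n) p i = 1 ->
  (forall i j : 'I_n, (i <= j)%N -> p j <= p i) ->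
  (forall j, measurable_fun setT (A j)) ->
  (forall j i, measurable [set w | X j w = i]) ->
  (forall j, measurable [set w | C j w]) ->
  (forall j s, 0 <= s ->
     P [set w | A j w <= s] = (1 - expR (- lambda * s))%:E) ->
  (forall j i, P [set w | X j w = i] = (p i)%:E) ->
  (forall j, P [set w | C j w] = alpha%:E) ->
  mutually_independent P A X C ->
  {ae P, forall w,
     avg_age k len (fun m => A m w) (fun m => X m w) (fun m => C m w) t
       @[t --> +oo] --> (Delta_alpha k p alpha lambda len)%:E}.
Proof.
move=> k0 kn lambda0 alpha01 p0 p1 p_nincr mA mX mC A_cdf X_pmf C_prob indep.
exact: (ae_avg_age_cvg len k0 kn lambda0 alpha01 p0 p1 p_nincr mA mX mC A_cdf X_pmf C_prob indep).
Qed.
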